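(* The space $\mathscr P$ is a Poisson algebra (it is closed under the Poisson bracket). Moreover $\mathscr C$ is generated by $(J_k)_{k\ge2}$, i.e. any element of $\mathscr C$ is expressed as a polynomial in the $J_k$, $k\ge 2$. Finally, for any $k_1,k_2\ge1$, $$\{J_{k_1},J_{k_2}\}=0.$$
   Context: The Kirchhoff-Pohozaev equation on $\mathbb T^n$ ($n\ge1$) is $u_{tt}-\big(1+\int_{\mathbb T^n}|\nabla u|^2dx\big)^{-2}\Delta u=0$, i.e. the Hamiltonian system $u_t=\nabla_vH$, $v_t=-\nabla_uH$ with $H(u,v)=\frac12\int_{\mathbb T^n}v^2dx-\frac12\frac1{1+\int_{\mathbb T^n}|\nabla u|^2dx}$ and Poisson bracket $\{F,G\}=\int_{\mathbb T^n}(\nabla_uF\nabla_vG-\nabla_vF\nabla_uG)dx$ ($L^2$-gradients). A function $P$ is a constant of motion if $\{P,H\}=0$. Notation: $\nabla^{2k}u=\Delta^ku$, $\nabla^{2k+1}u=\nabla(\Delta^ku)$, $\|\cdot\|$ is the $L^2(\mathbb T^n)$ norm. For $k\ge1$: $D_k=\|\nabla^ku\|^2$, $B_k=\|\nabla^{k-1}v\|^2$, $Q_k=\int_{\mathbb T^n}\nabla^{k-1}u\cdot\nabla^{k-1}v\,dx$, $A=\frac1{1+D_1}$, $E_k=\frac{B_k}A+AD_k$, $F_k=\frac{B_k}A-AD_k$. For $k\ge2$, $J_k=E_k-\sum_{j=2}^kQ_jQ_{k+2-j}+\frac14\sum_{j=2}^{k-1}(E_jE_{k+1-j}-F_jF_{k+1-j})$,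 and $J_1=A-B_1-1=-2H-1$. $\mathscr P$ is the ring of finite polynomials with real coefficients in the variables $\{E_k,F_k,Q_k\}_{k\ge2},A,1/A$, i.e. of finite linear combinations of monomials $A^{d}\prod_{k=2}^ME_k^{a_k}F_k^{b_k}Q_k^{c_k}$ with $a_k,b_k,c_k\in\mathbb N$, $d\in\mathbb Z$. $\mathscr C$ is the subring of those elements of $\mathscr P$ which are constants of motion of the Kirchhoff-Pohozaev equation. *)

(* Defs.v *)
From HB Require Import structures.
From mathcomp Require Import all_boot all_order all_algebra.
From mathcomp Require Import all_classical all_reals all_analysis.
Set Implicit Arguments.
Unset Strict Implicit.
Unset Printing Implicit Defensive.
Import Order.TTheory GRing.Theory Num.Theory.
Import numFieldNormedType.Exports.
Local Open Scope classical_set_scope.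
Local Open Scope ring_scope.

(* The torus T^n is (R / LZ)^n for an arbitrary period L > 0: functions on it
   are L-periodic functions on R^n, integrated over the cube [0, L]^n. *)

Section Calculus.
Variables (R : realType) (n : nat).
Implicit Types (f g : 'rV[R]_n -> R) (s : seq 'I_n).

Definition basis_vec (i : 'I_n) : 'rV[R]_n := delta_mx 0 i.

Definition partial (i : 'I_n) f : 'rV[R]_n -> R := fun x => 'D_(basis_vec i) f x.

Definition partials s f : 'rV[R]_n -> R := foldr partial f s.

Definition smooth f : Prop :=
  forall s, continuous (partials s f) /\
    forall i x, derivable (partials s f) x (basis_vec i).

Definition periodic (L : R) f : Prop :=
  forall i x, f (x + L *: basis_vec i) = f x.

Definition laplacian f : 'rV[R]_n -> R :=
  fun x => \sum_(i < n) partial i (partial i f) x.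

(* The pointwise product of nabla^k f and nabla^k g, where
   nabla^(2m) f = laplacian^m f is scalar and nabla^(2m+1) f is the gradient
   of laplacian^m f. *)
Definition nabla_dot (k : nat) f g (x : 'rV[R]_n) : R :=
  let f' := iter k./2 laplacian f in
  let g' := iter k./2 laplacian g in
  if odd k then \sum_(i < n) partial i f' x * partial i g' x else f' x * g' x.

End Calculus.

(* Integral over [0, L]^n, as an iterated Lebesgue integral; by Fubini this is
   the integral for the n-dimensional Lebesgue measure for continuous
   integrands, the only ones integrated below. *)
Fixpoint cube_int (R : realType) (L : R) (n : nat) :
    ('rV[R]_n -> R) -> R :=
  match n return ('rV[R]_n -> R) -> R with
  | 0 => fun f => f 0
  | n'.+1 => fun f =>
      \int[@lebesgue_measure R]_(t in `[0, L])
        cube_int L (fun y : 'rV[R]_n' => f (row_mx (t%:M : 'rV[R]_1) y))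
  end.

Section TorusFunctions.
Variables (R : realType) (n : nat) (L : R).

Definition smooth_torus : {pred 'rV[R]_n -> R} :=
  mem [set f | smooth f /\ periodic L f].

Lemma partials_lin (a : R) (f g : 'rV[R]_n -> R) (s : seq 'I_n) :
  smooth f -> smooth g ->
  partials s (a *: f + g) = a *: partials s f + partials s g.
Proof.
move=> sf sg; elim: s => [//|i s IH] /=; rewrite IH; apply/funext => x.
have df := (sf s).2 i x; have dg := (sg s).2 i x.
rewrite /partial deriveD ?deriveZ //.
exact: derivableZ.
Qed.

Lemma smooth_torus_submod : submod_closed smooth_torus.
Proof.
split.
  apply/mem_set; split; last by move=> i x.
  have H0 s : partials s (0 : 'rV[R]_n -> R) = 0.
    elim: s => [//|i s IH] /=; rewrite IH; apply/funext => x.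
    exact: derive_cst.
  move=> s; rewrite H0; split; first exact: cst_continuous.
  by move=> i x; exact: derivable_cst.
move=> a f g /set_mem [sf pf] /set_mem [sg pg]; apply/mem_set; split.
  move=> s; rewrite partials_lin //; have [cf df] := sf s.
  have [cg dg] := sg s; split.
    by move=> x; exact: (cvgD (cvgZ (cvg_cst a) (cf x)) (cg x)).
  move=> i x; apply: derivableD; last exact: dg.
  exact/derivableZ/df.
by move=> i x; rewrite /= !fctE pf pg.
Qed.

HB.instance Definition _ :=
  GRing.isSubmodClosed.Build R ('rV[R]_n -> R) smooth_torus
    smooth_torus_submod.

(* The real vector space of smooth functions on the torus. *)
Record torus_fun := TorusFun {
  torus_val :> 'rV[R]_n -> R;
  torus_valP : torus_val \in smooth_torus }.

HB.instance Definition _ := [isSub for torus_val].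
HB.instance Definition _ := [Choice of torus_fun by <:].
HB.instance Definition _ := [SubChoice_isSubLmodule of torus_fun by <:].

(* Phase space: w = (u, v). *)
Definition phase : Type := (torus_fun * torus_fun)%type.

(* Functionals on the phase space, a commutative ring for the pointwise
   operations. *)
Definition functional : Type := phase -> R.

End TorusFunctions.

HB.instance Definition _ (R : realType) (n : nat) (L : R) :=
  GRing.ComPzRing.copy (functional n L) (phase n L -> R).

Section Poisson.
Variables (R : realType) (n : nat) (L : R).
Local Notation fun_ := (torus_fun n L).
Local Notation phase := (phase n L).
Local Notation functional := (functional n L).
Implicit Types (F G K : functional) (w : phase) (g phi : fun_).

Definition is_grad_u F w g : Prop :=
  forall phi, is_derive (0 : R) (1 : R) (fun s : R => F (w.1 + s *: phi, w.2))
    (cube_int L (fun x => g x * phi x)).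

Definition is_grad_v F w g : Prop :=
  forall phi, is_derive (0 : R) (1 : R) (fun s : R => F (w.1, w.2 + s *: phi))
    (cube_int L (fun x => g x * phi x)).

Definition has_gradients F : Prop :=
  forall w, (exists g, is_grad_u F w g) /\ (exists g, is_grad_v F w g).

(* The L^2-gradients, meaningful when F satisfies [has_gradients]. *)
Definition grad_u F w : fun_ := xget 0 [set g | is_grad_u F w g].
Definition grad_v F w : fun_ := xget 0 [set g | is_grad_v F w g].

Definition bracket F G : functional := fun w =>
  cube_int L (fun x => grad_u F w x * grad_v G w x
                       - grad_v F w x * grad_u G w x).

(* Commutative algebra of functionals which is a Lie algebra for the bracket,
   the latter being a derivation in each argument. *)
Record poisson_algebra (S : set functional) : Prop := PoissonAlgebra {
  pa_const : forall c : R, S (fun=> c);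
  pa_add : forall F G, S F -> S G -> S (F + G);
  pa_mul : forall F G, S F -> S G -> S (F * G);
  pa_grad : forall F, S F -> has_gradients F;
  pa_bracket : forall F G, S F -> S G -> S (bracket F G);
  pa_linear : forall (c : R) F G K, S F -> S G -> S K ->
    bracket ((fun=> c) * F + G) K = (fun=> c) * bracket F K + bracket G K;
  pa_alternating : forall F G, S F -> S G -> bracket F G = - bracket G F;
  pa_leibniz : forall F G K, S F -> S G -> S K ->
    bracket (F * G) K = F * bracket G K + bracket F K * G;
  pa_jacobi : forall F G K, S F -> S G -> S K ->
    bracket F (bracket G K) + bracket G (bracket K F)
      + bracket K (bracket F G) = 0 }.

Definition Dk (k : nat) : functional := fun w =>
  cube_int L (nabla_dot k w.1 w.1).
Definition Bk (k : nat) : functional := fun w =>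
  cube_int L (nabla_dot k.-1 w.2 w.2).
Definition Qk (k : nat) : functional := fun w =>
  cube_int L (nabla_dot k.-1 w.1 w.2).
Definition Afun : functional := fun w => (1 + Dk 1 w)^-1.
Definition Ek (k : nat) : functional := fun w =>
  Bk k w / Afun w + Afun w * Dk k w.
Definition Fk (k : nat) : functional := fun w =>
  Bk k w / Afun w - Afun w * Dk k w.

Definition Ham : functional := fun w =>
  2^-1 * cube_int L (fun x => w.2 x ^+ 2)
  - 2^-1 * (1 + cube_int L (fun x => \sum_(i < n) partial i w.1 x ^+ 2))^-1.

(* The value at k = 0 is meaningless. *)
Definition Jk (k : nat) : functional := fun w =>
  if k == 1%N then Afun w - Bk 1 w - 1
  else Ek k w - \sum_(2 <= j < k.+1) Qk j w * Qk (k + 2 - j)%N w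
    + 4^-1 * \sum_(2 <= j < k)
        (Ek j w * Ek (k + 1 - j)%N w - Fk j w * Fk (k + 1 - j)%N w).

Definition monomial (M : nat) (d : int) (a b c : nat -> nat) : functional :=
  fun w => Afun w ^ d *
    \prod_(2 <= k < M.+1) (Ek k w ^+ a k * Fk k w ^+ b k * Qk k w ^+ c k).

Definition scrP : set functional :=
  [set F | exists (m M : nat) (coef : 'I_m -> R) (d : 'I_m -> int)
                  (a b c : 'I_m -> nat -> nat),
     F = fun w =>
       \sum_(i < m) coef i * monomial M (d i) (a i) (b i) (c i) w].

Definition constant_of_motion F : Prop :=
  has_gradients F /\ bracket F Ham = 0.

Definition scrC : set functional :=
  [set F | scrP F /\ constant_of_motion F].

Definition polynomials_in_J : set functional :=
  [set F | exists (m M : nat) (coef : 'I_m -> R) (a : 'I_m -> nat -> nat),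
     F = fun w =>
       \sum_(i < m) coef i * \prod_(2 <= k < M.+1) Jk k w ^+ a i k].

End Poisson.

(* Main.v *)
Require Import Defs.
From mathcomp Require Import all_boot all_order all_algebra.
From mathcomp Require Import all_classical all_reals all_analysis.
From mathcomp Require Import ring lra zify.
Import Order.TTheory GRing.Theory Num.Theory.
Import numFieldNormedType.Exports.
Set Implicit Arguments.
Unset Strict Implicit.
Unset Printing Implicit Defensive.
Local Open Scope classical_set_scope.
Local Open Scope ring_scope.

(** With [Lam] the positive Laplacian, all the functionals at hand are built from
    the quadratic forms d_i = <Lam^i u, u>, b_i = <Lam^i v, v> and
    q_i = <Lam^i u, v>, indexed by the power of [Lam].  Their gradients are
    powers of [Lam] applied to u or v, and symmetry of [Lam] makes them close
    under the bracket as a current algebra of sl_2: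
    {d_i, b_j} = 4 q_(i+j), {d_i, q_j} = 2 d_(i+j), {q_i, b_j} = 2 b_(i+j).
    As A = 1 / (1 + d_1), the bracket extends to polynomials in A and the forms
    by the Leibniz rule.  The analysis is confined to four facts on the iterated
    integral: it is linear, gradients are unique (positivity of the inner
    product), [Lam] is symmetric (integration by parts), and cosine modes are
    eigenfunctions.  The Jacobi identity holds because the Jacobiator is a
    derivation in each argument and vanishes on the forms; the relation
    A (1 + d_1) = 1 forces it to vanish on A as well.

    The bracket with the Hamiltonian, divided by A, acts on the generators by
    A -> - 2 A Q_2, E_k -> 2 Q_2 F_k, F_k -> 2 Q_2 E_k - 4 Q_(k+1), Q_k -> F_k
    ([bracket_Ham], written here with the indices of [Ek], [Fk], [Qk]), and J_k is annihilated because the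
    terms cancel in pairs ([Jexp_conserved]).  Conversely let P be annihilated.
    Since J_k is E_k plus terms of lower index, J, F, Q and A can serve as
    coordinates, in which J does not move.  If M is the largest index for which
    F_M or Q_M occurs in P, then Q_(M+1) enters the derivative of P only through
    - 4 Q_(M+1) dP/dF_M, so P does not depend on F_M; after that F_M enters only
    through F_M dP/dQ_M, so P does not depend on Q_M either.  Descending on M
    leaves a polynomial in A, 1/A and the J's, and the flow with Q_2 = -1/2 moves
    A through all positive values: A does not occur either ([stationary_poly]).

    This argument concerns polynomials, whereas a constant of motion is a
    functional.  The two are reconciled by [identity_everywhere]: combinations of
    cosine modes with suitable coefficients give the forms d, b, q any values
    linear in nonnegative parameters, a Vandermonde system shows that real
    parameters reach all values, and a rational function of one variable which
    vanishes on a sequence tending to 0 vanishes.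

    Finally {J_k, J_l} is a constant of motion by the Jacobi identity, hence a
    polynomial in the J's, hence even in v; but it is the bracket of two
    functionals even in v, hence odd in v.  So it is zero ([bracket_Jk_Jk]). *)

(** * Integrals over the cube *)

Section CubeIntegral.
Variables (R : realType) (L : R).
Hypothesis L_gt0 : 0 < L.

Definition cube n : set 'rV[R]_n := [set x | forall i, `[0, L]%classic (x 0 i)].

Lemma cube_compact n : compact (@cube n).
Proof.
exact: (rV_compact (fun=> @segment_compact R 0 L)).
Qed.

Definition slice n (f : 'rV[R]_n.+1 -> R) (t : R) (y : 'rV[R]_n) : R :=
  f (row_mx (t%:M : 'rV[R]_1) y).

Lemma continuous_row_mx n :
  continuous (fun p : R * 'rV[R]_n => row_mx (p.1%:M : 'rV[R]_1) p.2).
Proof.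
move=> [t y]; apply/cvg_ballP => e e0.
have := @nbhsx_ballx R (R * 'rV[R]_n)%type (t, y) e e0.
apply: filterS => p [/= pt [_ py]]; split => // i j; rewrite !mxE.
case: splitP => k _; last exact: py.
by rewrite !mxE (ord1 i) (ord1 k) !mulr1n.
Qed.

Lemma slice_continuous2 n (f : 'rV[R]_n.+1 -> R) : continuous f ->
  continuous (fun p : R * 'rV[R]_n => slice f p.1 p.2).
Proof.
move=> cf p.
exact: (@cvg_comp _ _ _ (fun p : R * 'rV[R]_n => row_mx (p.1%:M : 'rV[R]_1) p.2)
  f _ _ _ (@continuous_row_mx n p) (cf _)).
Qed.

Lemma slice_continuous n (f : 'rV[R]_n.+1 -> R) t : continuous f ->
  continuous (slice f t).
Proof.
move=> cf y.
have c1 : (fun z : 'rV[R]_n => (t, z)) @ nbhs y --> nbhs (t, y).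
  exact: (cvg_pair (f := fun=> t) (g := id) (cvg_cst t) cvg_id).
exact: (cvg_comp _ _ c1 (@slice_continuous2 n f cf (t, y))).
Qed.

(** Compactness of the cube makes continuity in the first coordinate uniform in
    the other ones. *)
Lemma slice_near n (f : 'rV[R]_n.+1 -> R) t e : continuous f -> 0 < e ->
  \forall s \near t, forall y, cube y -> `|slice f s y - slice f t y| < e.
Proof.
move=> cf e0.
have /compact_near_coveringP := @cube_compact n.
move=> /(_ R (nbhs t) (fun s y => `|slice f s y - slice f t y| < e) _); apply.
move=> y _.
have e20 : 0 < e / 2 by rewrite divr_gt0.
have := @slice_continuous2 _ _ cf (t, y).
move=> /cvgrPdist_lt /(_ _ e20) /= H.
case: H => -[U V] /= [Ut Vy] UV.
have := @slice_continuous _ _ t cf y => /cvgrPdist_lt /(_ _ e20) /= W.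
exists ((V `&` [set z | `|slice f t y - slice f t z| < e / 2]), U) => /=.
  by split => //; exact: filterI.
move=> [z s] /= [[Vz Wz] Us].
rewrite (_ : _ - _ = (slice f t y - slice f t z) - (slice f t y - slice f s z));
  last by ring.
rewrite (le_lt_trans (ler_normB _ _))// (splitr e) ltrD//.
exact: (UV (s, z)).
Qed.

Lemma integrable_segment (f : R -> R) (a b : R) : continuous f ->
  (@lebesgue_measure R).-integrable `[a, b] (EFin \o f).
Proof.
move=> cf; apply: continuous_compact_integrable; first exact: segment_compact.
exact: continuous_subspaceT.
Qed.

Lemma cube_intS n (f : 'rV[R]_n.+1 -> R) :
  cube_int L f = \int[@lebesgue_measure R]_(t in `[0, L]) cube_int L (slice f t).
Proof. by []. Qed.

(** Linearity and monotonicity at dimension [n] make the partial integrals of a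
    continuous function continuous, hence integrable at dimension [n.+1]; the
    two facts have to be proved together by induction on the dimension. *)
Definition cube_int_law n :=
  (forall (a : R) (f g : 'rV[R]_n -> R), continuous f -> continuous g ->
    cube_int L (fun x => a * f x + g x) = a * cube_int L f + cube_int L g) /\
  (forall f g : 'rV[R]_n -> R, continuous f -> continuous g ->
    (forall x, cube x -> f x <= g x) -> cube_int L f <= cube_int L g).

Lemma cube_int_cst n (c : R) : cube_int L (fun _ : 'rV[R]_n => c) = c * L ^+ n.
Proof.
elim: n => [|n IH]; first by rewrite expr0 mulr1.
rewrite cube_intS /slice IH Rintegral_cst//= lebesgue_measure_itv /=.
by rewrite lte_fin L_gt0 /= subr0 exprSr mulrA.
Qed.

Lemma cube_int_dist n (f g : 'rV[R]_n -> R) e : cube_int_law n ->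
  continuous f -> continuous g -> (forall x, cube x -> `|f x - g x| <= e) ->
  `|cube_int L f - cube_int L g| <= e * L ^+ n.
Proof.
move=> [lin mono] cf cg fg.
have cst (c : R) : continuous (fun _ : 'rV[R]_n => c) by exact: cst_continuous.
have cD c (h : 'rV[R]_n -> R) : continuous h -> continuous (fun x => 1 * h x + c).
  by move=> ch x; exact: (cvgD (cvgM (cvg_cst (1 : R)) (ch x)) (cvg_cst c)).
have sh c (h : 'rV[R]_n -> R) : continuous h ->
    cube_int L (fun x => 1 * h x + c) = cube_int L h + c * L ^+ n.
  by move=> ch; rewrite lin// mul1r cube_int_cst.
rewrite ler_distl -mulNr -!sh//; apply/andP; split; apply: mono => //;
  try exact: cD; move=> x /fg; rewrite ler_distl => /andP[]; lra.
Qed.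

Lemma cube_int_slice_continuous n (f : 'rV[R]_n.+1 -> R) : cube_int_law n ->
  continuous f -> continuous (fun t => cube_int L (slice f t)).
Proof.
move=> law cf t; apply/cvgrPdist_le => e e0 /=.
have Ln : 0 < L ^+ n by rewrite exprn_gt0.
near=> s; rewrite distrC.
have -> : e = e / L ^+ n * L ^+ n by rewrite divfK ?gt_eqF.
apply: cube_int_dist => //; try exact: slice_continuous.
move=> x cx; apply/ltW; move: x cx.
by near: s; apply: slice_near; rewrite ?divr_gt0.
Unshelve. all: by end_near. Qed.

Lemma cube_int_lawP n : cube_int_law n.
Proof.
elim: n => [|n IH]; first by split => [//|f g _ _]; apply => i; case: i.
have cs := cube_int_slice_continuous IH.
split=> [a f g cf cg|f g cf cg fg].
  rewrite !cube_intS -RintegralZl//; last exact/integrable_segment/cs.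
  rewrite -RintegralD//; try exact/integrable_segment/cs; last first.
    apply: (@integrable_segment (fun t => a * cube_int L (slice f t))) => t.
    exact: (cvgM (cvg_cst a) (cs f cf t)).
  apply: eq_Rintegral => t _.
  by rewrite -(IH.1 a)//; exact: slice_continuous.
rewrite !cube_intS; apply: le_Rintegral => //; try exact/integrable_segment/cs.
move=> t t0L; apply: IH.2; try exact: slice_continuous.
move=> y cy; apply: fg => i; rewrite mxE; case: splitP => k _; last exact: cy.
by rewrite mxE (ord1 k) eqxx mulr1n.
Qed.

Lemma cube_int_continuous n (f : 'rV[R]_n.+1 -> R) :
  continuous f -> continuous (fun t => cube_int L (slice f t)).
Proof. exact/cube_int_slice_continuous/cube_int_lawP. Qed.

Lemma cube_int_lin n a (f g : 'rV[R]_n -> R) : continuous f -> continuous g ->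
  cube_int L (fun x => a * f x + g x) = a * cube_int L f + cube_int L g.
Proof. exact: (cube_int_lawP n).1. Qed.

Lemma cube_intZ n a (f : 'rV[R]_n -> R) : continuous f ->
  cube_int L (fun x => a * f x) = a * cube_int L f.
Proof.
move=> cf; have := @cube_int_lin _ a f (fun=> 0) cf (@cst_continuous _ _ _).
rewrite cube_int_cst mul0r addr0 => <-; congr cube_int.
by apply/funext => x; rewrite addr0.
Qed.

Lemma cube_intB n (f g : 'rV[R]_n -> R) : continuous f -> continuous g ->
  cube_int L (fun x => f x - g x) = cube_int L f - cube_int L g.
Proof.
move=> cf cg; rewrite addrC -mulN1r -cube_int_lin//; congr cube_int.
by apply/funext => x; rewrite mulN1r addrC.
Qed.

Lemma cube_int_ge0 n (f : 'rV[R]_n -> R) : continuous f ->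
  (forall x, 0 <= f x) -> 0 <= cube_int L f.
Proof.
move=> cf f0; have := (cube_int_lawP n).2 (fun=> 0) f.
by rewrite cube_int_cst mul0r; apply => //; exact: cst_continuous.
Qed.

(** Where [f] is positive it is bounded below on an interval, which
    contributes to the integral. *)
Lemma Rintegral_ge0_eq0 (f : R -> R) : continuous f -> (forall x, 0 <= f x) ->
  \int[@lebesgue_measure R]_(t in `[0, L]) f t = 0 ->
  forall t, `[0, L]%classic t -> f t = 0.
Proof.
move=> cf f0 If t /= t0L; apply/eqP; apply: contraT => ft0.
have e0 : 0 < f t / 2 by rewrite divr_gt0// lt_neqAle eq_sym ft0 f0.
have /cvgrPdist_lt /(_ _ e0) /nbhs_ballP [d /= d0 Hd] := cf t.
(* [a, a + r] stays in [0, L] and in the ball, on one side of t or the other *)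
pose r := Num.min d L / 2.
have r0 : 0 < r by rewrite divr_gt0// lt_min d0.
have [rd rL] : r < d /\ r + r <= L.
  by rewrite /r; have [] := leP d L; move: d0 L_gt0; lra.
pose a := if t + r <= L then t else t - r.
have [a0 arL] : 0 <= a /\ a + r <= L.
  by rewrite /a; case: ifP; move: t0L; rewrite in_itv /=; lra.
have near_a (x : R) : x \in `[a, a + r] -> f t / 2 <= f x.
  rewrite in_itv /= => xa; have : ball t d x.
    rewrite /ball /= (le_lt_trans _ rd)// ler_distl.
    by move: xa; rewrite /a; case: ifP; lra.
  by move/Hd => /=; rewrite ltr_distl; lra.
have cI := integrable_segment _ _ cf.
have : (\int[@lebesgue_measure R]_(x in `[a, (a + r)%R]) (f t / 2)%:E <=
        \int[@lebesgue_measure R]_(x in `[0%R, L]) (f x)%:E)%E.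
  apply: (@le_trans _ _ (\int[@lebesgue_measure R]_(x in `[a, (a + r)%R]) (f x)%:E)%E).
    apply: ge0_le_integral => //=.
    - by move=> x _; rewrite lee_fin ltW.
    - by exact: (measurable_int _ (cI a (a + r))).
  apply: ge0_subset_integral => //=.
  - exact: (measurable_int _ (cI 0 L)).
  - by move=> x _; rewrite lee_fin.
  - by move=> x /=; rewrite !in_itv /=; lra.
rewrite integral_cst//= lebesgue_measure_itv /= lte_fin ltrDl r0.
rewrite -[X in (_ <= X)%E]fineK; last exact: integrable_fin_num (cI 0 L).
rewrite -/(Rintegral _ _ _) If -EFinD -EFinM lee_fin => H.
have : 0 < f t / 2 * (a + r - a) by rewrite mulr_gt0// addrAC subrr add0r.
by move=> /lt_le_trans /(_ H); rewrite ltxx.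
Qed.

Lemma cube_int_eq0 n (f : 'rV[R]_n -> R) : continuous f ->
  (forall x, 0 <= f x) -> cube_int L f = 0 -> forall x, cube x -> f x = 0.
Proof.
elim: n f => [|n IH] f cf f0 If x cx.
  by rewrite -If /=; congr f; apply/rowP => -[].
have := Rintegral_ge0_eq0 (cube_int_continuous cf) _ If.
have -> : x = row_mx ((x 0 0)%:M : 'rV_1) (@rsubmx _ 1 1 n x).
  apply/rowP => i; rewrite !mxE; case: splitP => k ik; rewrite !mxE.
    by rewrite (ord1 k) eqxx mulr1n; congr (x _ _); apply/val_inj; rewrite /= ik (ord1 k).
  by congr (x _ _); apply/val_inj.
move=> H; apply: (IH (slice f (x 0 0))); first exact: slice_continuous.
- by move=> y; exact: f0.
- apply: H => [t|]; last exact: cx.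
  by apply: cube_int_ge0 => [|y]; [exact: slice_continuous|exact: f0].
- by move=> i; rewrite mxE; exact: cx.
Qed.

End CubeIntegral.

Section LineDerivative.
Variables (R : realType) (V : normedModType R).

(** Directional derivatives are ordinary derivatives along lines, to which the
    one-variable theory applies. *)
Lemma is_derive_line (f : V -> R) x v (d : R) :
  is_derive x v f d <-> is_derive (0 : R) (1 : R) (fun h => f (h *: v + x)) d.
Proof.
have E : (fun h => h^-1 *: ((f \o shift x) (h *: v) - f x)) =
  (fun h => h^-1 *: (((fun h => f (h *: v + x)) \o shift 0) (h *: (1 : R)) -
    f (0 *: v + x))).
  by apply/funext => h /=; rewrite scale0r add0r /shift/= addr0 [h *: 1]mulr1.
by split=> -[H1 H2]; split; move: H1 H2; rewrite /derivable /derive E.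
Qed.

End LineDerivative.

Lemma is_derive_line_at (R : realType) (V : normedModType R) (f : V -> R) x v
  (s d : R) :
  is_derive (s *: v + x) v f d <-> is_derive s (1 : R) (fun h => f (h *: v + x)) d.
Proof.
rewrite is_derive_line [X in _ <-> X]is_derive_line.
suff -> : (fun h => f (h *: v + (s *: v + x))) =
  (fun h : R => f ((h *: (1 : R) + s) *: v + x)) by [].
by apply/funext => h; rewrite [h *: 1]mulr1 scalerDl addrA.
Qed.

Section DerivativeUnderIntegral.
Variables (R : realType) (L : R).
Hypothesis L_gt0 : 0 < L.

Lemma basis_vec0 n (s t : R) (y : 'rV[R]_n) :
  row_mx (t + s)%:M y = s *: @basis_vec R n.+1 ord0 + row_mx (t%:M : 'rV_1) y.
Proof.
apply/rowP => i; rewrite /basis_vec !mxE eqxx /=; case: splitP => k ik; rewrite ?mxE.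
  rewrite (ord1 k) eqxx !mulr1n (_ : i == ord0) ?mulr1 1?addrC//.
  by apply/eqP/val_inj; rewrite /= ik (ord1 k).
rewrite (_ : i == ord0 = false) ?mulr0 ?add0r//.
by apply/eqP => /(congr1 val); rewrite /= ik.
Qed.

Lemma basis_vecS n (s t : R) (y : 'rV[R]_n) (j : 'I_n) :
  row_mx (t%:M : 'rV_1) (s *: basis_vec R j + y) =
  s *: @basis_vec R n.+1 (lift ord0 j) + row_mx (t%:M : 'rV_1) y.
Proof.
apply/rowP => i; rewrite /basis_vec !mxE eqxx /=; case: splitP => k ik; rewrite ?mxE.
  rewrite (_ : i == lift ord0 j = false) ?mulr0 ?add0r//.
  by apply/eqP => /(congr1 val); rewrite /= ik (ord1 k).
have -> : i = lift ord0 k by apply/val_inj; rewrite /= ik.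
by rewrite (inj_eq lift_inj).
Qed.

Lemma is_derive_slice n (f df : 'rV[R]_n.+1 -> R) :
  (forall x, is_derive x (basis_vec R ord0) f (df x)) ->
  forall t y, is_derive t (1 : R) (fun s => slice f s y) (slice df t y).
Proof.
move=> dfE t y.
have [x0 E] : exists x0 : 'rV[R]_n.+1, forall s,
    (row_mx (s%:M : 'rV_1) y : 'rV[R]_n.+1) = s *: basis_vec R ord0 + x0.
  by exists (row_mx (0%:M : 'rV_1) y) => s; rewrite -basis_vec0 add0r.
have -> : (fun s => slice f s y) = (fun s => f (s *: basis_vec R ord0 + x0)).
  by apply/funext => s; exact: (congr1 f (E s)).
rewrite (congr1 df (E t) : slice df t y = _).
have [+ _] := is_derive_line_at f x0 (basis_vec R ord0) t
  (df (t *: basis_vec R ord0 + x0)).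
by apply; exact: dfE.
Qed.

(** The mean value theorem turns uniform continuity of the derivative into a
    uniform estimate of the difference quotients. *)
Lemma slice_increment n (f df : 'rV[R]_n.+1 -> R) (t h d e : R) y :
  (forall x, is_derive x (basis_vec R ord0) f (df x)) ->
  (forall s, `|s - t| < d -> `|slice df s y - slice df t y| <= e) ->
  h != 0 -> `|h| < d ->
  `|h^-1 * (slice f (h + t) y - slice f t y) - slice df t y| <= e.
Proof.
move=> dfE dfe h0 hd.
have dl := is_derive_slice dfE.
have cl (a b : R) : {within `[a, b], continuous (fun s => slice f s y)}.
  apply: continuous_subspaceT => s; apply: differentiable_continuous.
  by apply/derivable1_diffP; have [] := dl s y.
have [c [ct ->]] : exists c : R, `|c - t| < d /\
    slice f (h + t) y - slice f t y = slice df c y * h.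
  have [hn|hp] := ltP h 0.
    have ht : h + t <= t by lra.
    have [c + E] := MVT_segment ht (fun s _ => dl s y) (cl _ _).
    rewrite in_itv /= => cI; exists c; split; last by move: E; lra.
    by move: hd; rewrite ltr0_norm// ltr_distl; lra.
  have ht : t <= h + t by lra.
  have [c + E] := MVT_segment ht (fun s _ => dl s y) (cl _ _).
  rewrite in_itv /= => cI; exists c; split; last by rewrite E addrK.
  by move: hd; rewrite ger0_norm// ltr_distl; lra.
by rewrite mulrC mulfK//; exact: dfe.
Qed.

Lemma is_derive_cube_int n (f df : 'rV[R]_n.+1 -> R) :
  continuous f -> continuous df ->
  (forall x, is_derive x (basis_vec R ord0) f (df x)) ->
  forall t, is_derive t (1 : R) (fun t => cube_int L (slice f t))
    (cube_int L (slice df t)).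
Proof.
move=> cf cdf dfE t.
suff H : (fun h => h^-1 *: (((fun t => cube_int L (slice f t)) \o shift t)
    (h *: (1 : R)) - cube_int L (slice f t))) @ 0^' --> cube_int L (slice df t).
  by split; [exact: cvgP H|exact: cvg_lim H].
apply/cvgrPdist_le => e e0 /=.
have Ln : 0 < L ^+ n by rewrite exprn_gt0.
have eL : 0 < e / L ^+ n by rewrite divr_gt0.
have /nbhs_ballP [d /= d0 Hd] := slice_near L t cdf eL.
exists d => //= h; rewrite /ball /= sub0r normrN => hd h0.
have cs (g : 'rV[R]_n.+1 -> R) s : continuous g -> continuous (slice g s).
  exact: slice_continuous.
rewrite distrC /shift [h *: (1 : R)]mulr1.
have cB : continuous (fun y => slice f (h + t) y - slice f t y).
  by move=> y; exact: (cvgB (cs f (h + t) cf y) (cs f t cf y)).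
rewrite -cube_intB; try exact: cs; last by [].
rewrite [_ *: _](_ : _ = cube_int L (fun y => h^-1 *
    (slice f (h + t) y - slice f t y))); last by rewrite cube_intZ.
rewrite -[leRHS](@divfK _ (L ^+ n)) ?gt_eqF//.
apply: cube_int_dist => //; [exact: cube_int_lawP| |exact: cs|].
  by move=> y; exact: (cvgM (cvg_cst h^-1) (cB y)).
move=> y cy; apply: (@slice_increment _ _ _ _ _ d) => // s sd.
by apply/ltW/Hd => //; rewrite /ball /= distrC.
Qed.

(** In the outermost direction, differentiate under the inner integral and use
    the fundamental theorem of calculus and periodicity; the other directions
    are handled slice by slice. *)
Lemma cube_int_derivative n (i : 'I_n) (f df : 'rV[R]_n -> R) :
  continuous f -> continuous df ->
  (forall x, is_derive x (basis_vec R i) f (df x)) -> Defs.periodic L f ->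
  cube_int L df = 0.
Proof.
elim: n i f df => [[]//|n IH] i f df cf cdf dfE pf.
have cubeS := is_derive_cube_int cf cdf.
have [j ij|i0] := unliftP ord0 i.
  rewrite cube_intS (_ : (fun t => _) = fun=> 0); last first.
    apply/funext => t; apply: (IH j (slice f t)); try exact: slice_continuous.
      move=> y; apply/is_derive_line; rewrite /slice.
      under eq_fun do rewrite basis_vecS.
      have [+ _] := is_derive_line f (row_mx (t%:M : 'rV_1) y)
        (basis_vec R (lift ord0 j)) (slice df t y).
      by apply; rewrite -ij; exact: dfE.
    move=> k y; rewrite /slice addrC basis_vecS addrC; exact: pf.
  by rewrite Rintegral_cst// mul0r.
subst i; have {}cubeS := cubeS dfE.
have cc (a b : R) : {within `[a, b], continuous (fun t => cube_int L (slice df t))}.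
  exact/continuous_subspaceT/cube_int_continuous.
have ci := cube_int_continuous L_gt0 cf.
have := @continuous_FTC2 _ _ (fun t => cube_int L (slice f t)) 0 L L_gt0 (cc _ _).
rewrite cube_intS /Rintegral => ->; first 1 last.
- split => [t _||]; first by have [] := cubeS t.
    exact/cvg_at_right_filter/ci.
  exact/cvg_at_left_filter/ci.
- by move=> t _; rewrite derive1E; have [] := cubeS t.
rewrite (_ : slice f L = slice f 0) ?subee//.
apply/funext => y; rewrite /slice -[RHS](pf ord0); congr f.
by rewrite addrC -basis_vec0 add0r.
Qed.

End DerivativeUnderIntegral.

(** * The L2 inner product and the positive Laplacian *)

Section InnerProduct.
Variables (R : realType) (n : nat) (L : R).
Hypothesis L_gt0 : 0 < L.
Local Notation V := (torus_fun n L).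
Implicit Types (f g h : V) (i : 'I_n).

Lemma torus_smooth f : smooth f.
Proof. by have /set_mem [] := torus_valP f. Qed.

Lemma torus_periodic f : Defs.periodic L f.
Proof. by have /set_mem [] := torus_valP f. Qed.

Lemma torus_continuous f : continuous f.
Proof. exact: (torus_smooth f [::]).1. Qed.

Lemma torus_is_derive f i x : is_derive x (basis_vec R i) f (partial i f x).
Proof. by split => //; exact: (torus_smooth f [::]).2. Qed.

Lemma torus_valD f g x : (f + g) x = f x + g x. Proof. by []. Qed.
Lemma torus_valZ a f x : (a *: f) x = a * f x. Proof. by []. Qed.

Lemma partial_smooth_torus i f : partial i f \in @smooth_torus R n L.
Proof.
apply/mem_set; split.
  by move=> s; have := torus_smooth f (rcons s i); rewrite /partials foldr_rcons.
move=> j x; rewrite /partial /derive; set q := (X in X @ _).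
set q' := (X in _ = lim (X @ _)); suff -> : q = q' by [].
by apply/funext => h; rewrite /q /q' /= /shift /= addrA !(torus_periodic f).
Qed.

Definition tpartial i f : V := TorusFun (partial_smooth_torus i f).

Lemma tpartial_lin i a f g : tpartial i (a *: f + g) = a *: tpartial i f + tpartial i g.
Proof.
apply/val_inj/funext => x /=.
by have := @partials_lin R n a f g [:: i] (torus_smooth f) (torus_smooth g) => /= ->.
Qed.

Lemma tpartial0 i : tpartial i 0 = 0.
Proof.
have := tpartial_lin i 1 0 0; rewrite !scale1r addr0 => /eqP.
by rewrite -subr_eq0 opprD addNKr oppr_eq0 => /eqP.
Qed.

Lemma tpartialZ i a f : tpartial i (a *: f) = a *: tpartial i f.
Proof. by have := tpartial_lin i a f 0; rewrite tpartial0 !addr0. Qed.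

Definition ip f g : R := cube_int L (fun x => f x * g x).

Lemma torus_mulc f g : continuous (fun x => f x * g x).
Proof.
by move=> x; exact: (cvgM (@torus_continuous f x) (@torus_continuous g x)).
Qed.

Lemma ipC f g : ip f g = ip g f.
Proof. by congr cube_int; apply/funext => x; rewrite mulrC. Qed.

Lemma ip_linl a f g h : ip (a *: f + g) h = a * ip f h + ip g h.
Proof.
rewrite -cube_int_lin//; try exact: torus_mulc.
by congr cube_int; apply/funext => x; rewrite torus_valD torus_valZ; ring.
Qed.

Lemma ipDl f g h : ip (f + g) h = ip f h + ip g h.
Proof. by have := ip_linl 1 f g h; rewrite scale1r mul1r. Qed.

Lemma ip0l h : ip 0 h = 0.
Proof.
have := ipDl 0 0 h; rewrite addr0 => /eqP.
by rewrite -subr_eq0 opprD addNKr oppr_eq0 => /eqP.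
Qed.

Lemma ipZl a f h : ip (a *: f) h = a * ip f h.
Proof. by have := ip_linl a f 0 h; rewrite addr0 ip0l addr0. Qed.

Lemma ipNl f h : ip (- f) h = - ip f h.
Proof. by rewrite -scaleN1r ipZl mulN1r. Qed.

Lemma ipBl f g h : ip (f - g) h = ip f h - ip g h.
Proof. by rewrite ipDl ipNl. Qed.

Lemma ipDr f g h : ip h (f + g) = ip h f + ip h g.
Proof. by rewrite ipC ipDl !(ipC h). Qed.

Lemma ipZr a f h : ip h (a *: f) = a * ip h f.
Proof. by rewrite ipC ipZl (ipC h). Qed.

Lemma ip_ge0 f : 0 <= ip f f.
Proof.
apply: cube_int_ge0 => //; first exact: torus_mulc.
by move=> x; rewrite -expr2 sqr_ge0.
Qed.

(** Translating each coordinate by an integer multiple of the period brings any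
    point into the cube, so a periodic function is determined there. *)
Lemma torus_eq_cube f : (forall x, cube L x -> f x = 0) -> f = 0.
Proof.
move=> f0; apply/val_inj/funext => x /=.
have natP i (m : nat) y : f (y + (L * m%:R) *: basis_vec R i) = f y.
  elim: m => [|m IH]; first by rewrite mulr0 scale0r addr0.
  by rewrite -natr1 mulrDr mulr1 scalerDl addrA torus_periodic.
have intP i (m : int) y : f (y + (L * m%:~R) *: basis_vec R i) = f y.
  case: m => m; first exact: natP.
  by rewrite NegzE mulrNz -(natP i m.+1) mulrN scaleNr subrK.
pose q i : R := x 0 i / L.
have sumP (s : seq 'I_n) y :
    f (y + \sum_(i <- s) (L * (- Num.floor (q i))%:~R) *: basis_vec R i) = f y.
  elim: s y => [|i s IH] y; first by rewrite big_nil addr0.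
  by rewrite big_cons addrA IH intP.
rewrite -(sumP (enum 'I_n)); apply: f0 => j /=.
rewrite mxE big_enum summxE (bigD1 j)//= big1 => [|i ij]; last first.
  by rewrite !mxE eq_sym (negbTE ij) andbF mulr0.
rewrite !mxE !eqxx mulr1 addr0 in_itv /=.
have -> : x 0 j = L * q j by rewrite mulrC divfK ?gt_eqF.
rewrite -mulrDr mulrNz.
have := floor_le (q j); have := floorD1_gt (q j).
rewrite intrD => h1 h2; apply/andP; split.
  by apply: mulr_ge0; [exact: ltW|lra].
by rewrite -[leRHS]mulr1 ler_pM2l//; lra.
Qed.

Lemma ip_eq0 f : ip f f = 0 -> f = 0.
Proof.
move=> /cube_int_eq0 H; apply: torus_eq_cube => x cx.
have := H L_gt0 (@torus_mulc f f) _ x cx; rewrite -expr2 => H'.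
by apply/eqP; rewrite -sqrf_eq0 H'// => y; rewrite -expr2 sqr_ge0.
Qed.

Lemma ip_gt0 f : f != 0 -> 0 < ip f f.
Proof.
move=> f0; rewrite lt_neqAle ip_ge0 andbT eq_sym; apply: contra f0 => /eqP.
by move/ip_eq0 => ->.
Qed.

(** Integration by parts: the integral of the derivative of the periodic
    function [f * g] vanishes. *)
Lemma ip_tpartial i f g : ip (tpartial i f) g = - ip f (tpartial i g).
Proof.
apply/eqP; rewrite -addr_eq0; apply/eqP.
rewrite /ip -[X in X + _]mul1r -cube_int_lin//; try exact: torus_mulc.
apply: (@cube_int_derivative _ _ L_gt0 _ i (fun x => f x * g x)).
- exact: torus_mulc.
- move=> x; exact: (cvgD (cvgM (cvg_cst (1 : R)) (@torus_mulc (tpartial i f) g x))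
    (@torus_mulc f (tpartial i g) x)).
- move=> x; have := is_deriveM (torus_is_derive f i x) (torus_is_derive g i x).
  by rewrite mul1r addrC [_ * g x]mulrC.
- by move=> j x; rewrite !torus_periodic.
Qed.

(** The sign makes [ip (Lam f) f] nonnegative. *)
Definition Lam f : V := - \sum_i tpartial i (tpartial i f).

Lemma Lam_lin a f g : Lam (a *: f + g) = a *: Lam f + Lam g.
Proof.
rewrite /Lam scalerN -opprD scaler_sumr -big_split /=; congr (- _).
by apply: eq_bigr => i _; rewrite !tpartial_lin.
Qed.

Lemma ip_suml (I : Type) (s : seq I) (F : I -> V) h :
  ip (\sum_(i <- s) F i) h = \sum_(i <- s) ip (F i) h.
Proof. by apply: (big_morph (fun f => ip f h)) => [f g|]; rewrite ?ipDl ?ip0l. Qed.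

Lemma cube_int_sum_mul (I : Type) (s : seq I) (F G : I -> V) :
  cube_int L (fun x => \sum_(i <- s) F i x * G i x) = \sum_(i <- s) ip (F i) (G i).
Proof.
elim: s => [|i s IH].
  by under eq_fun do rewrite big_nil; rewrite big_nil cube_int_cst// mul0r.
have cont (r : seq I) : continuous (fun x => \sum_(i <- r) F i x * G i x).
  elim: r => [|j r IHr] x.
    by under eq_fun do rewrite big_nil; exact: cst_continuous.
  under eq_fun do rewrite big_cons.
  exact: (cvgD (@torus_mulc (F j) (G j) x) (IHr x)).
under eq_fun do rewrite big_cons -[X in X + _]mul1r.
by rewrite cube_int_lin// ?mul1r ?IH ?big_cons//; exact: torus_mulc.
Qed.

Lemma ip_Lam f g : ip (Lam f) g = \sum_i ip (tpartial i f) (tpartial i g).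
Proof.
rewrite ipNl ip_suml -sumrN; apply: eq_bigr => i _.
by rewrite ip_tpartial opprK.
Qed.

Lemma Lam_sym f g : ip (Lam f) g = ip f (Lam g).
Proof. by rewrite ip_Lam ipC ip_Lam; apply: eq_bigr => i _; rewrite ipC. Qed.

Definition Lamn k f : V := iter k Lam f.

Lemma Lamn_lin k a f g : Lamn k (a *: f + g) = a *: Lamn k f + Lamn k g.
Proof. by elim: k => [//|k IH]; rewrite /Lamn /= -!/(Lamn _ _) IH Lam_lin. Qed.

Lemma ip_Lamn j k f g : ip (Lamn j f) (Lamn k g) = ip (Lamn (j + k) f) g.
Proof.
elim: k j => [|k IH] j; first by rewrite addn0.
by rewrite -addSnnS -IH /Lamn !iterS Lam_sym.
Qed.

Lemma sum_torus_val (I : Type) (s : seq I) (F : I -> V) x :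
  (\sum_(i <- s) F i : V) x = \sum_(i <- s) F i x.
Proof. exact: (big_morph (fun f : V => f x)). Qed.

Lemma laplacian_Lam f : laplacian f = (- Lam f : V) :> (_ -> R).
Proof. by apply/funext => x; rewrite opprK sum_torus_val. Qed.

Lemma Lam_scale a f : Lam (a *: f) = a *: Lam f.
Proof.
have L0 : Lam 0 = 0.
  have := Lam_lin 1 0 0; rewrite !scale1r addr0 => /eqP.
  by rewrite -subr_eq0 opprD addNKr oppr_eq0 => /eqP.
by have := Lam_lin a f 0; rewrite L0 !addr0.
Qed.

Lemma iter_laplacian k f :
  iter k (@laplacian R n) f = ((-1) ^+ k *: Lamn k f : V) :> (_ -> R).
Proof.
elim: k => [|k IH]; first by rewrite expr0 scale1r.
by rewrite iterS IH laplacian_Lam Lam_scale -scaleN1r scalerA exprS.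
Qed.

(** Both parities of [nabla ^ k] give the quadratic form of the [k]-th power
    of the positive Laplacian. *)
Lemma cube_int_nabla_dot k f g : cube_int L (nabla_dot k f g) = ip (Lamn k f) g.
Proof.
have sgn m : (-1) ^+ m * ((-1) ^+ m) = 1 :> R by rewrite -exprMn mulrNN mulr1 expr1n.
rewrite -[in RHS](odd_double_half k); case ok: (odd k).
  rewrite [nabla_dot _ _ _](_ : _ = fun x => \sum_i
     tpartial i (Lamn k./2 f) x * tpartial i (Lamn k./2 g) x); last first.
    apply/funext => x; rewrite /nabla_dot ok !iter_laplacian; apply: eq_bigr => i _.
    transitivity (tpartial i ((-1) ^+ k./2 *: Lamn k./2 f) x *
      tpartial i ((-1) ^+ k./2 *: Lamn k./2 g) x) => //.
    by rewrite !tpartialZ !torus_valZ mulrACA sgn mul1r.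
  have -> : (true + k./2.*2 = k./2.+1 + k./2)%N by rewrite -addnn.
  by rewrite cube_int_sum_mul -ip_Lam -ip_Lamn.
rewrite [nabla_dot _ _ _](_ : _ = fun x => Lamn k./2 f x * Lamn k./2 g x).
  by rewrite -[LHS]/(ip _ _) ip_Lamn addnn.
apply/funext => x; rewrite /nabla_dot ok !iter_laplacian !torus_valZ.
by rewrite mulrACA sgn mul1r.
Qed.

End InnerProduct.

Arguments Lamn : simpl never.

(** * Cosine modes *)

Section Waves.
Variables (R : realType) (n : nat) (L : R).
Hypothesis L_gt0 : 0 < L.
Variable i0 : 'I_n.
Local Notation V := (torus_fun n L).

(** The span of cosine and sine of one frequency is stable under partial
    derivatives, which gives smoothness at once. *)
Definition wave (k a b : R) (x : 'rV[R]_n) : R :=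
  a * cos (k * x 0 i0) + b * sin (k * x 0 i0).

Lemma is_derive_wave k a b j x : is_derive x (basis_vec R j) (wave k a b)
  (wave k ((j == i0)%:R * (k * b)) (- ((j == i0)%:R * (k * a))) x).
Proof.
apply/is_derive_line; set d : R := (j == i0)%:R.
have -> : (fun h => wave k a b (h *: basis_vec R j + x)) =
    (fun h => a * cos (k * (h * d + x 0 i0)) + b * sin (k * (h * d + x 0 i0))).
  by apply/funext => h; rewrite /wave !mxE eqxx /= eq_sym.
have lin : is_derive (0 : R) (1 : R) (fun h => k * (h * d + x 0 i0)) (k * d).
  have -> : (fun h => k * (h * d + x 0 i0)) = (k * d) *: id + cst (k * x 0 i0).
    by apply/funext => h; rewrite !fctE /= mulrDr [_ *: h]mulrAC mulrA.
  by apply: is_derive_eq; rewrite addr0 [_ *: 1]mulr1.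
have C := @is_derive1_comp R (@cos R) (fun h => k * (h * d + x 0 i0)) _ _ _
  (is_derive_cos _) lin.
have S := @is_derive1_comp R (@sin R) (fun h => k * (h * d + x 0 i0)) _ _ _
  (is_derive_sin _) lin.
apply: (is_derive_eq (is_deriveD (is_deriveZ a C) (is_deriveZ b S))).
rewrite /wave mul0r add0r /GRing.scale /=; ring.
Qed.

Lemma partial_wave k a b j : partial j (wave k a b) =
  wave k ((j == i0)%:R * (k * b)) (- ((j == i0)%:R * (k * a))).
Proof. by apply/funext => x; have [] := is_derive_wave k a b j x. Qed.

Lemma wave_continuous k a b : continuous (wave k a b).
Proof.
have lin : continuous (fun x : 'rV[R]_n => k * x 0 i0).
  move=> x; exact: (cvgM (cvg_cst k) (@coord_continuous R _ _ _ _ x)).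
move=> x.
exact: (cvgD
  (cvgM (cvg_cst a) (continuous_comp (@lin x) (@continuous_cos R _)))
  (cvgM (cvg_cst b) (continuous_comp (@lin x) (@continuous_sin R _)))).
Qed.

Lemma wave_smooth k a b : smooth (wave k a b).
Proof.
have H s : exists a' b', partials s (wave k a b) = wave k a' b'.
  elim: s => [|j s [a' [b' IH]]]; first by exists a, b.
  by rewrite /= IH partial_wave; eexists; eexists.
move=> s; have [a' [b' ->]] := H s; split; first exact: wave_continuous.
by move=> i x; have [] := is_derive_wave k a' b' i x.
Qed.

Definition freq (m : nat) : R := m.+1%:R * (2 * pi) / L.

Lemma mode_proof m : wave (freq m) 1 0 \in @smooth_torus R n L.
Proof.
apply/mem_set; split; first exact: wave_smooth.
move=> j x; rewrite /wave !mul0r !addr0 !mul1r !mxE eqxx /=.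
have [_|] := eqVneq i0 j; last by rewrite mulr0 addr0.
rewrite mulr1 mulrDr divfK ?gt_eqF//.
move: (freq m * _) => y; elim: m.+1 => [|q IH]; first by rewrite mul0r addr0.
rewrite -natr1 mulrDl mul1r addrA -IH.
by rewrite [2 * pi]mulr_natl cosD2pi.
Qed.

Definition mode m : V := TorusFun (mode_proof m).
Definition eigval m : R := freq m ^+ 2.

Lemma Lam_mode m : Lam (mode m) = eigval m *: mode m.
Proof.
apply/val_inj/funext => x /=.
rewrite -[RHS]/(eigval m * wave (freq m) 1 0 x).
rewrite -[LHS]/(- (\sum_i tpartial i (tpartial i (mode m)) : V) x) sum_torus_val.
rewrite (bigD1 i0)//= big1 => [|j ji].
  by rewrite addr0 /= !partial_wave eqxx !mul1r /wave /eigval; ring.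
by rewrite /= !partial_wave (negbTE ji) !mul0r /wave; ring.
Qed.

Lemma freq_gt0 m : 0 < freq m.
Proof. by rewrite divr_gt0// mulr_gt0// mulr_gt0// pi_gt0. Qed.

Lemma eigval_gt0 m : 0 < eigval m. Proof. by rewrite exprn_gt0// freq_gt0. Qed.

Lemma eigval_inj : injective eigval.
Proof.
move=> m p /eqP; rewrite eqrXn2 ?ltW ?freq_gt0// => /eqP.
move/(congr1 (fun x => x * L / (2 * pi))); rewrite /freq !divfK ?gt_eqF//.
by rewrite !mulfK ?gt_eqF ?mulr_gt0 ?pi_gt0// => /eqP; rewrite eqr_nat => /eqP[].
Qed.

Lemma mode_neq0 m : mode m != 0.
Proof.
apply/eqP => /(congr1 (fun f : V => f 0)) H.
have : wave (freq m) 1 0 0 = 0 := H.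
by rewrite /wave mxE mulr0 cos0 mulr1 mul0r addr0 => /eqP; rewrite oner_eq0.
Qed.

(** The operator is symmetric and the eigenvalues are distinct. *)
Lemma mode_ortho m p : m != p -> ip (mode m) (mode p) = 0.
Proof.
move=> mp; have := Lam_sym L_gt0 (mode m) (mode p).
rewrite !Lam_mode ipZl// ipZr// => /eqP; rewrite -subr_eq0 -mulrBl mulf_eq0.
by rewrite subr_eq0 (inj_eq eigval_inj) (negbTE mp) => /eqP.
Qed.

End Waves.

(** * Polynomial expressions and their differentials *)

Section PolynomialExpressions.
Variable R : realType.

Inductive pexp (V : Type) : Type :=
  | PC of R
  | PV of V
  | PAdd of pexp V & pexp V
  | PMul of pexp V & pexp V.

Arguments PC {V}.

Fixpoint peval V (f : V -> R) (e : pexp V) : R :=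
  match e with
  | PC c => c
  | PV v => f v
  | PAdd a b => peval f a + peval f b
  | PMul a b => peval f a * peval f b
  end.

(** The differential of [e] at the point [f], applied to the tangent vector
    [df].  Tangent coordinates in an arbitrary module let the same definition
    serve for directional derivatives (in [R]) and for gradients (in the space
    of functions on the torus). *)
Fixpoint pdiff (M : lmodType R) V (f : V -> R) (df : V -> M) (e : pexp V) : M :=
  match e with
  | PC _ => 0
  | PV v => df v
  | PAdd a b => pdiff f df a + pdiff f df b
  | PMul a b => peval f a *: pdiff f df b + peval f b *: pdiff f df a
  end.

(** The derivation of the polynomial ring with prescribed values on the
    variables, as an operation on expressions. *)
Fixpoint pder V (s : V -> pexp V) (e : pexp V) : pexp V :=
  match e with
  | PC _ => PC 0
  | PV v => s v
  | PAdd a b => PAdd (pder s a) (pder s b)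
  | PMul a b => PAdd (PMul a (pder s b)) (PMul b (pder s a))
  end.

Fixpoint psubst V W (s : V -> pexp W) (e : pexp V) : pexp W :=
  match e with
  | PC c => PC c
  | PV v => s v
  | PAdd a b => PAdd (psubst s a) (psubst s b)
  | PMul a b => PMul (psubst s a) (psubst s b)
  end.

Fixpoint pvars V (P : V -> Prop) (e : pexp V) : Prop :=
  match e with
  | PC _ => True
  | PV v => P v
  | PAdd a b | PMul a b => pvars P a /\ pvars P b
  end.

Lemma eq_peval V (P : V -> Prop) (f g : V -> R) e :
  (forall v, P v -> f v = g v) -> pvars P e -> peval f e = peval g e.
Proof.
by move=> fg; elim: e => //= [a IHa b IHb|a IHa b IHb] [/IHa -> /IHb ->].
Qed.

Lemma eq_pdiff (M : lmodType R) V (P : V -> Prop) (f g : V -> R) (df dg : V -> M) e :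
  (forall v, P v -> f v = g v) -> (forall v, P v -> df v = dg v) ->
  pvars P e -> pdiff f df e = pdiff g dg e.
Proof.
move=> fg dfg; elim: e => //= [a IHa b IHb|a IHa b IHb] [Pa Pb];
  rewrite (IHa Pa) (IHb Pb)//.
by rewrite (eq_peval fg Pa) (eq_peval fg Pb).
Qed.

Lemma pvarsT V (e : pexp V) : pvars (fun=> True) e.
Proof. by elim: e => //= a IHa b IHb. Qed.

Lemma sub_pvars V (P Q : V -> Prop) e : (forall v, P v -> Q v) ->
  pvars P e -> pvars Q e.
Proof.
by move=> PQ; elim: e => //= [a IHa b IHb|a IHa b IHb] [/IHa ? /IHb ?].
Qed.

Lemma pvars_pder V (P : V -> Prop) s e : (forall v, P v -> pvars P (s v)) ->
  pvars P e -> pvars P (pder s e).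
Proof.
by move=> Ps; elim: e => //= [a IHa b IHb|a IHa b IHb] [/[dup] ? /IHa ?
  /[dup] ? /IHb ?].
Qed.

Lemma pvars_psubst V W (P : V -> Prop) (Q : W -> Prop) s e :
  (forall v, P v -> pvars Q (s v)) -> pvars P e -> pvars Q (psubst s e).
Proof.
by move=> Ps; elim: e => //= [a IHa b IHb|a IHa b IHb] [/IHa ? /IHb ?].
Qed.

Lemma peval_pder V (f : V -> R) s e :
  peval f (pder s e) = pdiff f (fun v => peval f (s v) : R^o) e.
Proof. by elim: e => //= a -> b ->. Qed.

Lemma peval_psubst V W (s : V -> pexp W) f e :
  peval f (psubst s e) = peval (fun v => peval f (s v)) e.
Proof. by elim: e => //= a -> b ->. Qed.

Lemma pdiff_psubst (M : lmodType R) V W (s : V -> pexp W) f (df : W -> M) e :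
  pdiff f df (psubst s e) =
  pdiff (fun v => peval f (s v)) (fun v => pdiff f df (s v)) e.
Proof. by elim: e => //= a -> b ->//; rewrite !peval_psubst. Qed.

Lemma pdiff_map (M N : lmodType R) (l : M -> N) V f (df : V -> M) e :
  (forall a x y, l (a *: x + y) = a *: l x + l y) ->
  l (pdiff f df e) = pdiff f (fun v => l (df v)) e.
Proof.
move=> ll.
have lD x y : l (x + y) = l x + l y by rewrite -[x]scale1r ll !scale1r.
have l0 : l 0 = 0 by apply/eqP; rewrite -[_ == _](inj_eq (addrI (l 0))) -lD !addr0.
have lZ a x : l (a *: x) = a *: l x by rewrite -[a *: x]addr0 ll l0 addr0.
by elim: e => //= a IHa b IHb; rewrite lD ?lZ IHa IHb.
Qed.

Lemma pdiff_lin (M : lmodType R) V f a (df dg : V -> M) e :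
  pdiff f (fun v => a *: df v + dg v) e = a *: pdiff f df e + pdiff f dg e.
Proof.
elim: e => //= [_|x -> y ->|x -> y ->]; first by rewrite scaler0 addr0.
  by rewrite scalerDr addrACA.
by rewrite !scalerDr !scalerA ![a * _]mulrC addrACA.
Qed.

(** Ties the syntactic [pdiff] to calculus: it is the derivative of the value
    along any curve with the given velocity. *)
Lemma is_derive_peval V (c : R -> V -> R) (dc : V -> R) t e :
  (forall v, is_derive t (1 : R) (c ^~ v) (dc v)) ->
  is_derive t (1 : R) (fun s => peval (c s) e) (pdiff (c t) (dc : V -> R^o) e).
Proof.
move=> dcE; elim: e => [r|v|a IHa b IHb|a IHa b IHb] /=.
- exact: is_derive_cst.
- exact: dcE.
- exact: (is_deriveD IHa IHb).
- exact: (is_deriveM IHa IHb).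
Qed.

Lemma pdiff0_peval_const V (c : R -> V -> R) (dc : R -> V -> R) e :
  (forall t v, is_derive t (1 : R) (c ^~ v) (dc t v)) ->
  (forall t, pdiff (c t) (dc t : V -> R^o) e = 0) ->
  forall s t, peval (c s) e = peval (c t) e.
Proof.
move=> dcE d0 s t; apply: (@is_derive_0_is_cst _ (fun s => peval (c s) e)) => x.
by rewrite -(d0 x); exact: is_derive_peval.
Qed.

(** Different expressions may have the same values; by the chain rule the
    differential only depends on the latter. *)
Lemma eq_pdiff_curve V (c : R -> V -> R) (dc : V -> R) t e e' :
  (forall v, is_derive t (1 : R) (c ^~ v) (dc v)) ->
  (forall s, peval (c s) e = peval (c s) e') ->
  pdiff (c t) (dc : V -> R^o) e = pdiff (c t) (dc : V -> R^o) e'.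
Proof.
move=> dcE /funext ee'; have := is_derive_peval e' dcE; rewrite -ee' => -[_ <-].
by have [_ <-] := is_derive_peval e dcE.
Qed.

Fixpoint psum V (s : seq (pexp V)) : pexp V :=
  if s is e :: s' then PAdd e (psum s') else PC 0.

Definition pscale V (c : R) (e : pexp V) := PMul (PC c) e.

Lemma peval_psum V (f : V -> R) I (s : seq I) (F : I -> pexp V) :
  peval f (psum [seq F i | i <- s]) = \sum_(i <- s) peval f (F i).
Proof. by elim: s => [|i s IH] /=; rewrite ?big_nil// big_cons IH. Qed.

Lemma pdiff_psum (M : lmodType R) V f (df : V -> M) I (s : seq I) (F : I -> pexp V) :
  pdiff f df (psum [seq F i | i <- s]) = \sum_(i <- s) pdiff f df (F i).
Proof. by elim: s => [|i s IH] /=; rewrite ?big_nil// big_cons IH. Qed.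

Lemma pvars_psum V (P : V -> Prop) (I : eqType) (s : seq I) (F : I -> pexp V) :
  (forall i, i \in s -> pvars P (F i)) -> pvars P (psum [seq F i | i <- s]).
Proof.
elim: s => //= i s IH H; split; first by apply: H; rewrite mem_head.
by apply: IH => j js; apply: H; rewrite in_cons js orbT.
Qed.

End PolynomialExpressions.

Arguments PC {R V}.
Arguments PV {R V}.

(** * Gradients and brackets of the quadratic functionals *)

Inductive kind := kD | kB | kQ.

(** [mA] stands for A and [mX k i] for <Lam^i u, u>, <Lam^i v, v> or
    <Lam^i u, v>.  Indexing by the power of [Lam] makes brackets additive in the
    index. *)
Inductive mgen := mA | mX of kind & nat.

Section Brackets.
Variables (R : realType) (n : nat) (L : R).
Hypothesis L_gt0 : 0 < L.
Local Notation V := (torus_fun n L).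
Local Notation phase := (phase n L).
Local Notation functional := (functional n L).
Implicit Types (w : phase) (e : pexp R mgen).

Definition mval w (c : mgen) : R :=
  match c with
  | mA => (1 + ip (Lamn 1 w.1) w.1)^-1
  | mX kD i => ip (Lamn i w.1) w.1
  | mX kB i => ip (Lamn i w.2) w.2
  | mX kQ i => ip (Lamn i w.1) w.2
  end.

Definition mgrad_u w (c : mgen) : V :=
  match c with
  | mA => (- 2 * mval w mA ^+ 2) *: Lamn 1 w.1
  | mX kD i => 2 *: Lamn i w.1
  | mX kB i => 0
  | mX kQ i => Lamn i w.2
  end.

Definition mgrad_v w (c : mgen) : V :=
  match c with
  | mA | mX kD _ => 0
  | mX kB i => 2 *: Lamn i w.2
  | mX kQ i => Lamn i w.1
  end.

Definition qfun e : functional := fun w => peval (mval w) e.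

Lemma mA_den_gt0 w : 0 < 1 + ip (Lamn 1 w.1) w.1.
Proof.
rewrite ltr_pwDl// /Lamn /= ip_Lam//.
by apply: sumr_ge0 => i _; exact: ip_ge0.
Qed.

Lemma mvalA_gt0 w : 0 < mval w mA. Proof. by rewrite invr_gt0 mA_den_gt0. Qed.

Lemma is_derive_quad (c0 c1 c2 : R) :
  is_derive (0 : R) (1 : R) (fun s => c0 + s * c1 + s * (s * c2)) c1.
Proof.
have -> : (fun s => c0 + s * c1 + s * (s * c2)) =
    cst c0 + (c1 *: id) + (id * (c2 *: id)).
  by apply/funext => s; rewrite !fctE /= /GRing.scale /= [s * c1]mulrC [s * c2]mulrC.
have id1 := is_derive_id (0 : R) (1 : R).
apply: (is_derive_eq (is_deriveD (is_deriveD (is_derive_cst c0 _ _)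
  (is_deriveZ c1 id1)) (is_deriveM id1 (is_deriveZ c2 id1)))).
by change (0 + c1 * 1 + (0 * (c2 * 1) + (c2 * 0) * 1) = c1); ring.
Qed.

Lemma Lamn_line i f g (s : R) : Lamn i (f + s *: g) = Lamn i f + s *: Lamn i g :> V.
Proof. by rewrite addrC Lamn_lin addrC. Qed.

Lemma ip_Lamn_line i f g h k (s : R) :
  ip (Lamn i (f + s *: g : V)) (h + s *: k) = ip (Lamn i f) h
    + s * (ip (Lamn i f) k + ip (Lamn i g) h) + s * (s * ip (Lamn i g) k).
Proof. by rewrite Lamn_line !(ipDl, ipDr, ipZl, ipZr)//; ring. Qed.

Lemma ip_Lamn_sym i (f g : V) : ip (Lamn i f) g = ip (Lamn i g) f.
Proof.
have := ip_Lamn L_gt0 0 i f g; rewrite add0n => <-.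
by rewrite ipC.
Qed.

(** Along a line the forms are polynomials of degree two, with the expected
    linear coefficient since [Lam] is symmetric. *)
Lemma mval_grad_u w phi c :
  is_derive (0 : R) (1 : R) (fun s => mval (w.1 + s *: phi, w.2) c)
    (ip (mgrad_u w c) phi).
Proof.
have D i : is_derive (0 : R) (1 : R)
    (fun s => ip (Lamn i (w.1 + s *: phi)) (w.1 + s *: phi))
    (2 * ip (Lamn i w.1) phi).
  under eq_fun do rewrite ip_Lamn_line.
  apply: (is_derive_eq (is_derive_quad _ _ _)).
  by rewrite (ip_Lamn_sym i phi); ring.
case: c => [|[] i] /=.
- have := @is_deriveV R (fun s => 1 + ip (Lamn 1 (w.1 + s *: phi)) (w.1 + s *: phi))
    0 (0 + 2 * ip (Lamn 1 w.1) phi) 1.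
  rewrite scale0r addr0 => H; apply: (is_derive_eq (H _ _)).
    by rewrite gt_eqF ?mA_den_gt0.
  rewrite add0r ipZl// -[_ *: _]/(_ * _) exprVn; ring.
- by rewrite ipZl.
- by rewrite ip0l//; exact: is_derive_cst.
- have -> : (fun s => ip (Lamn i (w.1 + s *: phi)) w.2) =
      (fun s => ip (Lamn i w.1) w.2 + s * ip (Lamn i w.2) phi + s * (s * 0)).
    apply/funext => s; rewrite Lamn_line ipDl// ipZl// (ip_Lamn_sym i phi).
    by rewrite !mulr0 addr0.
  exact: is_derive_quad.
Qed.

Lemma mval_grad_v w phi c :
  is_derive (0 : R) (1 : R) (fun s => mval (w.1, w.2 + s *: phi) c)
    (ip (mgrad_v w c) phi).
Proof.
case: c => [|[] i] /=.
- by rewrite ip0l//; exact: is_derive_cst.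
- by rewrite ip0l//; exact: is_derive_cst.
- under eq_fun do rewrite ip_Lamn_line.
  apply: (is_derive_eq (is_derive_quad _ _ _)).
  by rewrite ipZl// (ip_Lamn_sym i phi); ring.
- have -> : (fun s => ip (Lamn i w.1) (w.2 + s *: phi)) =
      (fun s => ip (Lamn i w.1) w.2 + s * ip (Lamn i w.1) phi + s * (s * 0)).
    by apply/funext => s; rewrite ipDr// ipZr// !mulr0 addr0.
  exact: is_derive_quad.
Qed.

Definition qfun_grad_u e w : V := pdiff (mval w) (mgrad_u w) e.
Definition qfun_grad_v e w : V := pdiff (mval w) (mgrad_v w) e.

Lemma phase_eta w phi : ((w.1 + 0 *: phi, w.2) = w) * ((w.1, w.2 + 0 *: phi) = w).
Proof. by split; rewrite scale0r addr0; case: w. Qed.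

Lemma pdiff_ip w (dw : mgen -> V) e g :
  ip (pdiff (mval w) dw e) g = pdiff (mval w) (fun c => ip (dw c) g : R^o) e.
Proof.
by apply: (@pdiff_map R V R^o (fun f => ip f g)) => a x y; rewrite ip_linl.
Qed.

Lemma qfun_is_grad_u e w : is_grad_u (qfun e) w (qfun_grad_u e w).
Proof.
move=> phi; rewrite -[cube_int _ _]/(ip _ _) pdiff_ip.
have := is_derive_peval e (mval_grad_u w phi).
by rewrite phase_eta.
Qed.

Lemma qfun_is_grad_v e w : is_grad_v (qfun e) w (qfun_grad_v e w).
Proof.
move=> phi; rewrite -[cube_int _ _]/(ip _ _) pdiff_ip.
have := is_derive_peval e (mval_grad_v w phi).
by rewrite phase_eta.
Qed.

Lemma ip_inj (g h : V) : (forall phi, ip g phi = ip h phi) -> g = h.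
Proof.
move=> gh; apply/eqP; rewrite -subr_eq0; apply/eqP/(ip_eq0 L_gt0).
by rewrite ipBl// gh subrr.
Qed.

(** Gradients are unique, so any field satisfying the defining identity is the
    chosen one. *)
Lemma grad_uE (F : functional) w g : is_grad_u F w g -> grad_u F w = g.
Proof.
move=> Fg; apply: ip_inj => phi; rewrite /grad_u.
have /xgetPex := ex_intro (fun g => is_grad_u F w g) g Fg.
by move=> /(_ 0 phi) [_ H]; rewrite -[LHS]H; have [] := Fg phi.
Qed.

Lemma grad_vE (F : functional) w g : is_grad_v F w g -> grad_v F w = g.
Proof.
move=> Fg; apply: ip_inj => phi; rewrite /grad_v.
have /xgetPex := ex_intro (fun g => is_grad_v F w g) g Fg.
by move=> /(_ 0 phi) [_ H]; rewrite -[LHS]H; have [] := Fg phi.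
Qed.

Lemma qfun_has_gradients e : has_gradients (qfun e).
Proof.
by move=> w; split; eexists; [exact: qfun_is_grad_u|exact: qfun_is_grad_v].
Qed.

Lemma bracket_ip (F G : functional) w :
  bracket F G w = ip (grad_u F w) (grad_v G w) - ip (grad_v F w) (grad_u G w).
Proof.
rewrite /ip -(cube_intB L_gt0)//.
  exact: (@torus_mulc R n L (grad_u F w) (grad_v G w)).
exact: (@torus_mulc R n L (grad_v F w) (grad_u G w)).
Qed.

Lemma bracket_qfun e1 e2 w : bracket (qfun e1) (qfun e2) w =
  ip (qfun_grad_u e1 w) (qfun_grad_v e2 w) - ip (qfun_grad_v e1 w) (qfun_grad_u e2 w).
Proof.
by rewrite bracket_ip !(grad_uE (@qfun_is_grad_u _ w)) !(grad_vE (@qfun_is_grad_v _ w)).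
Qed.

(** The quadratic functionals close under the bracket: they form a current
    algebra of sl_2, with this table of structure constants. *)
Definition kcoef (k l : kind) : R :=
  match k, l with
  | kD, kB => 4 | kB, kD => - 4 | kD, kQ => 2 | kQ, kD => - 2
  | kQ, kB => 2 | kB, kQ => - 2 | _, _ => 0
  end.

Definition kprod (k l : kind) : kind :=
  match k, l with
  | kD, kB | kB, kD => kQ
  | kQ, kB | kB, kQ => kB
  | _, _ => kD
  end.

Definition xbr k i l j : pexp R mgen :=
  PMul (PC (kcoef k l)) (PV (mX (kprod k l) (i + j))).

Definition mbr (c d : mgen) : pexp R mgen :=
  match c, d with
  | mA, mA => PC 0
  | mX k i, mX l j => xbr k i l j
  | mA, mX l j => PMul (PMul (PC (- 1)) (PMul (PV mA) (PV mA))) (xbr kD 1 l j)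
  | mX k i, mA => PMul (PMul (PC (- 1)) (PMul (PV mA) (PV mA))) (xbr k i kD 1)
  end.

Lemma mbrE w c d : peval (mval w) (mbr c d) =
  ip (mgrad_u w c) (mgrad_v w d) - ip (mgrad_v w c) (mgrad_u w d).
Proof.
have ipc (f g : V) i j : ip (Lamn i f) (Lamn j g) = ip (Lamn (i + j) g) f.
  by rewrite ip_Lamn// ip_Lamn_sym.
case: c d => [|[] i] [|[] j] /=;
  rewrite ?(ip0l, ipZl, ipZr)// ?[ip _ 0]ipC ?ip0l ?ip_Lamn// ?ipc;
  rewrite ?(ip_Lamn_sym _ w.2 w.1); ring.
Qed.

Definition mbracket e1 e2 : pexp R mgen :=
  pder (fun c => pder (mbr c) e2) e1.

Lemma bracket_qfunE e1 e2 : bracket (qfun e1) (qfun e2) = qfun (mbracket e1 e2).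
Proof.
apply/funext => w; rewrite bracket_qfun /qfun /mbracket peval_pder.
rewrite /qfun_grad_u /qfun_grad_v !pdiff_ip.
have -> (x y : R) : x - y = - 1 *: (y : R^o) + x by rewrite scaleN1r addrC.
rewrite -pdiff_lin; congr pdiff; apply/funext => c.
rewrite peval_pder [ip (mgrad_u w c) _]ipC [ip (mgrad_v w c) _]ipC !pdiff_ip -pdiff_lin.
congr pdiff; apply/funext => d.
by rewrite mbrE [ip (mgrad_v w d) _]ipC [ip (mgrad_u w d) _]ipC scaleN1r addrC.
Qed.

End Brackets.

(** * The Poisson algebra laws *)

(** In the indexing of [Dk], [Bk], [Qk], these are A, D_k for k >= 1, and B_k,
    Q_k for k >= 2. *)
Definition mpos (c : mgen) : Prop := if c is mX _ i then (0 < i)%N else True.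

Section PoissonLaws.
Variables (R : realType) (n : nat) (L : R).
Hypothesis L_gt0 : 0 < L.
Local Notation functional := (functional n L).
Local Notation qfun := (@qfun R n L).
Implicit Types (a b c e : pexp R mgen).

Lemma mbracket_pos a b : pvars mpos a -> pvars mpos b -> pvars mpos (mbracket a b).
Proof.
move=> pa pb; apply: pvars_pder pa => c pc; apply: pvars_pder pb => d pd.
case: c d pc pd => [|k i] [|l j] //= i0 j0; repeat split => //=.
- by rewrite addn1.
- by rewrite addn_gt0 i0.
Qed.

Lemma qfunD a b : qfun (PAdd a b) = qfun a + qfun b. Proof. by []. Qed.
Lemma qfunM a b : qfun (PMul a b) = qfun a * qfun b. Proof. by []. Qed.
Lemma qfunC r : qfun (PC r) = (fun=> r). Proof. by []. Qed.

Lemma bracketC a b : bracket (qfun a) (qfun b) = - bracket (qfun b) (qfun a).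
Proof.
apply/funext => w; rewrite -[RHS]/(- bracket (qfun b) (qfun a) w) !bracket_qfun//.
rewrite opprB [ip (qfun_grad_u b w) _]ipC [ip (qfun_grad_v b w) _]ipC.
by rewrite addrC.
Qed.

Lemma bracketDl a b c :
  bracket (qfun a + qfun b) (qfun c) =
  bracket (qfun a) (qfun c) + bracket (qfun b) (qfun c).
Proof.
rewrite -qfunD; apply/funext => w.
rewrite -[RHS]/(bracket (qfun a) (qfun c) w + bracket (qfun b) (qfun c) w).
rewrite !bracket_qfun// /qfun_grad_u /qfun_grad_v /= !ipDl//; ring.
Qed.

Lemma bracketMl a b c : bracket (qfun a * qfun b) (qfun c) =
  qfun a * bracket (qfun b) (qfun c) + bracket (qfun a) (qfun c) * qfun b.
Proof.
rewrite -qfunM; apply/funext => w.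
rewrite -[RHS]/(qfun a w * bracket (qfun b) (qfun c) w
  + bracket (qfun a) (qfun c) w * qfun b w).
rewrite !bracket_qfun// /qfun_grad_u /qfun_grad_v /= !ipDl// !ipZl// /qfun; ring.
Qed.

Lemma bracketKl r c : bracket (fun=> r) (qfun c) = 0.
Proof.
rewrite -qfunC; apply/funext => w; rewrite bracket_qfun//.
by rewrite /qfun_grad_u /qfun_grad_v /= !ip0l// subr0.
Qed.

Lemma bracketDr a b c :
  bracket (qfun c) (qfun a + qfun b) =
  bracket (qfun c) (qfun a) + bracket (qfun c) (qfun b).
Proof. by rewrite -qfunD bracketC qfunD bracketDl opprD -!bracketC. Qed.

Lemma bracketMr a b c : bracket (qfun c) (qfun a * qfun b) =
  qfun a * bracket (qfun c) (qfun b) + bracket (qfun c) (qfun a) * qfun b.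
Proof. by rewrite -qfunM bracketC qfunM bracketMl opprD -mulrN -mulNr -!bracketC. Qed.

Definition jac (F G K : functional) : functional :=
  bracket F (bracket G K) + bracket G (bracket K F) + bracket K (bracket F G).

Lemma jac_cycle F G K : jac F G K = jac G K F.
Proof. by rewrite /jac -addrA addrC. Qed.

Lemma jacD a b c e : jac (qfun a + qfun b) (qfun c) (qfun e) =
  jac (qfun a) (qfun c) (qfun e) + jac (qfun b) (qfun c) (qfun e).
Proof.
rewrite /jac bracketDr bracketDl !(bracket_qfunE n L_gt0) !bracketDr bracketDl.
by rewrite !(bracket_qfunE n L_gt0); ring.
Qed.

(** The Jacobiator is a derivation in its first argument; the products of two
    brackets produced by the Leibniz rule cancel by antisymmetry. *)
Lemma jacM a b c e : jac (qfun a * qfun b) (qfun c) (qfun e) =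
  qfun a * jac (qfun b) (qfun c) (qfun e) + qfun b * jac (qfun a) (qfun c) (qfun e).
Proof.
have brE := bracket_qfunE n L_gt0.
have E1 : bracket (qfun a * qfun b) (bracket (qfun c) (qfun e)) =
    qfun a * bracket (qfun b) (bracket (qfun c) (qfun e)) +
    bracket (qfun a) (bracket (qfun c) (qfun e)) * qfun b.
  by rewrite (brE c e) bracketMl.
have E2 : bracket (qfun c) (bracket (qfun e) (qfun a * qfun b)) =
    qfun a * bracket (qfun c) (bracket (qfun e) (qfun b)) +
      bracket (qfun c) (qfun a) * bracket (qfun e) (qfun b) +
    (bracket (qfun e) (qfun a) * bracket (qfun c) (qfun b) +
      bracket (qfun c) (bracket (qfun e) (qfun a)) * qfun b).
  rewrite bracketMr (brE e b) (brE e a) -!qfunM bracketDr !qfunM.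
  by rewrite (bracketMr a _ c) (bracketMr _ b c).
have E3 : bracket (qfun e) (bracket (qfun a * qfun b) (qfun c)) =
    qfun a * bracket (qfun e) (bracket (qfun b) (qfun c)) +
      bracket (qfun e) (qfun a) * bracket (qfun b) (qfun c) +
    (bracket (qfun a) (qfun c) * bracket (qfun e) (qfun b) +
      bracket (qfun e) (bracket (qfun a) (qfun c)) * qfun b).
  rewrite bracketMl (brE b c) (brE a c) -!qfunM bracketDr !qfunM.
  by rewrite (bracketMr a _ e) (bracketMr _ b e).
rewrite /jac E1 E2 E3 (bracketC c a) (bracketC c b); ring.
Qed.

Lemma jacK r c e : jac (fun=> r) (qfun c) (qfun e) = 0.
Proof.
have z d : bracket (qfun d) (0 : functional) = 0.
  by rewrite -[0 : functional]/(fun=> 0) -qfunC bracketC qfunC bracketKl oppr0.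
have zr d : bracket (qfun d) (fun=> r) = 0.
  by rewrite -qfunC bracketC qfunC bracketKl oppr0.
by rewrite /jac zr bracketKl !z (bracket_qfunE n L_gt0) bracketKl !addr0.
Qed.

Lemma qfun_den : qfun (PMul (PV mA) (PAdd (PC 1) (PV (mX kD 1)))) = (fun=> 1).
Proof. by apply/funext => w; rewrite /qfun /= mulVf// gt_eqF// mA_den_gt0. Qed.

(** Differentiating A * (1 + D_1) = 1 brings the variable A down to D_1. *)
Lemma jac_gen c e : (forall k i, jac (qfun (PV (mX k i))) (qfun c) (qfun e) = 0) ->
  forall a, jac (qfun a) (qfun c) (qfun e) = 0.
Proof.
move=> H; have HA : jac (qfun (PV mA)) (qfun c) (qfun e) = 0.
  have := jacK 1 c e; rewrite -qfun_den qfunM jacM qfunD jacD jacK H addr0 mulr0 add0r.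
  move=> E; apply/funext => w; have := congr1 (fun F : functional => F w) E.
  move=> /eqP; rewrite mulf_eq0 => /orP[|/eqP //].
  by rewrite -[X in X == _]/(1 + _) gt_eqF// mA_den_gt0.
elim=> [r|[|k i]|a IHa b IHb|a IHa b IHb] //.
- by rewrite qfunC jacK.
- by rewrite qfunD jacD IHa IHb addr0.
- by rewrite qfunM jacM IHa IHb !mulr0 addr0.
Qed.

Lemma qfun_xbr k i l j : bracket (qfun (PV (mX k i))) (qfun (PV (mX l j))) =
  qfun (xbr R k i l j).
Proof. by rewrite (bracket_qfunE n L_gt0). Qed.

Lemma jac_quadratic k i l j m p :
  jac (qfun (PV (mX k i))) (qfun (PV (mX l j))) (qfun (PV (mX m p))) = 0.
Proof.
have xx k1 i1 k2 i2 k3 i3 :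
    bracket (qfun (PV (mX k1 i1)))
      (bracket (qfun (PV (mX k2 i2))) (qfun (PV (mX k3 i3)))) =
    (fun=> kcoef R k2 k3 * kcoef R k1 (kprod k2 k3)) *
      qfun (PV (mX (kprod k1 (kprod k2 k3)) (i1 + (i2 + i3)))).
  rewrite qfun_xbr /xbr qfunM bracketMr qfunC qfun_xbr.
  rewrite -qfunC bracketC bracketKl oppr0 mul0r addr0.
  by apply/funext => w; rewrite /qfun /= -[LHS]/(_ * (_ * _)) mulrA.
rewrite /jac !xx; apply/funext => w.
have -> : (j + (p + i) = i + (j + p))%N by rewrite addnA addnC.
have -> : (p + (i + j) = i + (j + p))%N by rewrite addnC addnA.
rewrite -[LHS]/(_ * _ + _ * _ + _ * _). rewrite -[RHS]/(0 : R).
case: k l m => [] [] []; rewrite /kcoef /=; ring.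
Qed.

(** Cyclic symmetry gives the vanishing one argument at a time. *)
Lemma jac_qfun a b c : jac (qfun a) (qfun b) (qfun c) = 0.
Proof.
apply: jac_gen => k i; rewrite jac_cycle; apply: jac_gen => l j.
rewrite jac_cycle; apply: jac_gen => m p; exact: jac_quadratic.
Qed.

End PoissonLaws.

(** * Laurent monomials *)

Inductive ckind := xE | xF | xQ.

(** [cA], [cAi] stand for A, 1/A and [cX] for E, F, Q of index [i + 2]: with
    the shift, the sums defining the J's are plain convolutions. *)
Inductive cgen := cA | cAi | cX of ckind & nat.

Section NormalForm.
Variables (R : realType) (T : Type) (A : T -> R) (E F Q : nat -> T -> R).
Hypothesis A_neq0 : forall w, A w != 0.

Definition gval (w : T) (c : cgen) : R :=
  match c with
  | cA => A w
  | cAi => (A w)^-1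
  | cX xE i => E i.+2 w
  | cX xF i => F i.+2 w
  | cX xQ i => Q i.+2 w
  end.

Definition gmon (M : nat) (d : int) (a b c : nat -> nat) (w : T) : R :=
  A w ^ d * \prod_(2 <= k < M.+1) (E k w ^+ a k * F k w ^+ b k * Q k w ^+ c k).

Definition is_poly (H : T -> R) := exists e, forall w, H w = peval (gval w) e.

Lemma is_poly_cst r : is_poly (fun=> r). Proof. by exists (PC r). Qed.

Lemma is_polyD G H : is_poly G -> is_poly H -> is_poly (fun w => G w + H w).
Proof. by move=> [e eE] [e' e'E]; exists (PAdd e e') => w /=; rewrite eE e'E. Qed.

Lemma is_polyM G H : is_poly G -> is_poly H -> is_poly (fun w => G w * H w).
Proof. by move=> [e eE] [e' e'E]; exists (PMul e e') => w /=; rewrite eE e'E. Qed.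

Lemma is_polyX m G : is_poly G -> is_poly (fun w => G w ^+ m).
Proof.
move=> pG; elim: m => [|m IH]; first exact: is_poly_cst.
by under eq_fun do rewrite exprS; exact: is_polyM.
Qed.

Lemma is_poly_sum I (s : seq I) (G : I -> T -> R) : (forall i, is_poly (G i)) ->
  is_poly (fun w => \sum_(i <- s) G i w).
Proof.
move=> pG; elim: s => [|i s IH].
  by under eq_fun do rewrite big_nil; exact: is_poly_cst.
by under eq_fun do rewrite big_cons; exact: is_polyD.
Qed.

Lemma is_poly_gmon M d a b c : is_poly (gmon M d a b c).
Proof.
have gen x : is_poly (fun w => gval w x) by exists (PV x).
apply: is_polyM.
  case: d => m; first exact: (is_polyX m (gen cA)).
  have := is_polyX m.+1 (gen cAi).
  by under eq_fun do rewrite /= exprVn.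
rewrite (_ : (fun w => _) = fun w => \prod_(k <- iota 0 M.-1)
    (E k.+2 w ^+ a k.+2 * F k.+2 w ^+ b k.+2 * Q k.+2 w ^+ c k.+2)).
  elim: (iota 0 _) => [|k s IH].
    by under eq_fun do rewrite big_nil; exact: is_poly_cst.
  under eq_fun do rewrite big_cons; apply: is_polyM => //.
  apply: is_polyM; last exact: is_polyX (gen (cX xQ k)).
  by apply: is_polyM; [exact: is_polyX (gen (cX xE k))|exact: is_polyX (gen (cX xF k))].
apply/funext => w; rewrite /index_iota (_ : M.+1 - 2 = M.-1)%N ?subSS ?subn1//.
by rewrite (iotaDl 2 0) big_map.
Qed.

Local Notation term := (R * int * (nat -> nat) * (nat -> nat) * (nat -> nat))%type.

Definition tval M (t : term) w : R :=
  let: (r, d, a, b, c) := t in r * gmon M d a b c w.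

Definition cut M (a : nat -> nat) k := if (k <= M)%N then a k else 0%N.

Definition tcut M (t : term) : term :=
  let: (r, d, a, b, c) := t in (r, d, cut M a, cut M b, cut M c).

(** Monomials of bound [M] become monomials of bound [N] once their exponents
    beyond [M] are cut off; this gives the terms of a sum a common bound. *)
Lemma tcutE M N t w : (M <= N)%N -> tval N (tcut M t) w = tval M t w.
Proof.
case: t => [[[[r d] a] b] c] MN; rewrite /tval /tcut /gmon; congr (_ * (_ * _)).
rewrite [RHS](big_nat_widen _ _ N.+1)//= [RHS]big_mkcond /=.
apply: eq_bigr => k _; rewrite /cut ltnS; case: leqP => //.
by rewrite !expr0 !mulr1.
Qed.

Definition tmul (t u : term) : term :=
  let: (r, d, a, b, c) := t in let: (r', d', a', b', c') := u in
  (r * r', d + d', fun k => (a k + a' k)%N, fun k => (b k + b' k)%N,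
   fun k => (c k + c' k)%N).

Lemma tmulE M t u w : tval M (tmul t u) w = tval M t w * tval M u w.
Proof.
case: t u => [[[[r d] a] b] c] [[[[r' d'] a'] b'] c'] /=.
rewrite [RHS]mulrACA; congr (_ * _).
rewrite /gmon expfzDr// [RHS]mulrACA; congr (_ * _); rewrite -big_split /=.
by apply: eq_bigr => k _; rewrite !exprD [RHS]mulrACA; congr (_ * _); rewrite mulrACA.
Qed.

Definition has_nf (H : T -> R) :=
  exists M (s : seq term), forall w, H w = \sum_(t <- s) tval M t w.

Lemma nfD G H : has_nf G -> has_nf H -> has_nf (fun w => G w + H w).
Proof.
move=> [M [s sE]] [N [u uE]]; exists (maxn M N), (map (tcut M) s ++ map (tcut N) u).
move=> w; rewrite sE uE big_cat !big_map /=.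
by congr (_ + _); apply: eq_bigr => t _; rewrite tcutE// (leq_maxl, leq_maxr).
Qed.

Lemma nfM G H : has_nf G -> has_nf H -> has_nf (fun w => G w * H w).
Proof.
move=> [M [s sE]] [N [u uE]].
exists (maxn M N), [seq tmul (tcut M t) (tcut N t') | t <- s, t' <- u] => w.
rewrite sE uE big_allpairs_dep /= mulr_suml; apply: eq_bigr => t _.
rewrite mulr_sumr; apply: eq_bigr => t' _.
by rewrite tmulE !tcutE// (leq_maxl, leq_maxr).
Qed.

Lemma nf_gval c : has_nf (gval ^~ c).
Proof.
pose z (_ : nat) := 0%N; pose dl i (k : nat) : nat := (k == i.+2).
have prod0 M w : \prod_(2 <= k < M.+1) (E k w ^+ z k * F k w ^+ z k * Q k w ^+ z k) = 1.
  by rewrite big1// => k _; rewrite !expr0 !mulr1.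
have last (G : nat -> R) i : (forall k, k != i.+2 -> G k = 1) ->
    \prod_(2 <= k < i.+3) G k = G i.+2.
  move=> G1; rewrite big_nat_recr//= big_nat big1 ?mul1r// => k /andP[_ ki].
  by rewrite G1// ltn_eqF.
have dlE i : dl i i.+2 = 1%N by rewrite /dl eqxx.
have dl0 i k : k != i.+2 -> dl i k = 0%N by rewrite /dl => /negbTE ->.
case: c => [||[] i].
- exists 0%N, [:: (1, 1, z, z, z)] => w.
  by rewrite big_seq1 /tval /gmon prod0 mulr1 mul1r expr1z.
- exists 0%N, [:: (1, -1, z, z, z)] => w.
  by rewrite big_seq1 /tval /gmon prod0 mulr1 mul1r.
- exists i.+2, [:: (1, 0, dl i, z, z)] => w; rewrite big_seq1 /tval /gmon last.
    by rewrite dlE /= !mulr1 !mul1r.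
  by move=> k /dl0 ->; rewrite !mulr1.
- exists i.+2, [:: (1, 0, z, dl i, z)] => w; rewrite big_seq1 /tval /gmon last.
    by rewrite dlE /= !mulr1 !mul1r.
  by move=> k /dl0 ->; rewrite !mulr1.
- exists i.+2, [:: (1, 0, z, z, dl i)] => w; rewrite big_seq1 /tval /gmon last.
    by rewrite dlE /= !mulr1 !mul1r.
  by move=> k /dl0 ->; rewrite !mulr1.
Qed.

Lemma nf_peval e : has_nf (fun w => peval (gval w) e).
Proof.
elim: e => [r|v|a IHa b IHb|a IHa b IHb] /=.
- exists 0%N, [:: (r, 0, fun=> 0%N, fun=> 0%N, fun=> 0%N)] => w.
  by rewrite big_seq1 /tval /gmon big1 ?mulr1// => k _; rewrite !expr0 !mulr1.
- exact: nf_gval.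
- exact: nfD.
- exact: nfM.
Qed.

(** Lets structural induction on expressions replace the manipulation of
    monomials.  The functions A, E, F, Q are arbitrary so as to cover both the
    Laurent polynomials in A, E, F, Q and the polynomials in the J's. *)
Lemma is_polyP (H : T -> R) : is_poly H <->
  exists (m M : nat) (coef : 'I_m -> R) (d : 'I_m -> int)
    (a b c : 'I_m -> nat -> nat),
    H = fun w => \sum_(i < m) coef i * gmon M (d i) (a i) (b i) (c i) w.
Proof.
split=> [[e eE]|[m [M [coef [d [a [b [c ->]]]]]]]]; last first.
  by apply: is_poly_sum => i; apply: is_polyM; [exact: is_poly_cst|exact: is_poly_gmon].
have [M [s sE]] := nf_peval e.
exists (size s), M; pose t (i : 'I_(size s)) := tnth (in_tuple s) i.
exists (fun i => (t i).1.1.1.1), (fun i => (t i).1.1.1.2), (fun i => (t i).1.1.2),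
  (fun i => (t i).1.2), (fun i => (t i).2).
apply/funext => w; rewrite eE sE big_tnth; apply: eq_bigr => i _.
by rewrite -/(t i); case: (t i) => [[[[r d] a] b] c].
Qed.

End NormalForm.

(** * The Poisson algebra P *)

Lemma pdiffZ (R : realType) (M : lmodType R) V f a (df : V -> M) (e : pexp R V) :
  pdiff f (fun v => a *: df v) e = a *: pdiff f df e.
Proof.
elim: e => //= [_|x -> y ->|x -> y ->]; rewrite ?scaler0 ?scalerDr//.
by rewrite !scalerA ![a * _]mulrC.
Qed.

Lemma regE (R : realType) (x y : R) : x *: (y : R^o) = x * y.
Proof. by []. Qed.

Section AlgebraP.
Variables (R : realType) (n : nat) (L : R).
Hypothesis L_gt0 : 0 < L.
Local Notation phase := (phase n L).
Local Notation functional := (functional n L).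
Local Notation qfun := (@qfun R n L).
Implicit Types (w : phase).

Definition cval w : cgen -> R :=
  gval (@Afun R n L) (@Ek R n L) (@Fk R n L) (@Qk R n L) w.

Definition cfun (e : pexp R cgen) : functional := fun w => peval (cval w) e.

Lemma DkE k w : Dk k w = ip (Lamn k w.1) w.1.
Proof. exact: cube_int_nabla_dot. Qed.
Lemma BkE k w : Bk k w = ip (Lamn k.-1 w.2) w.2.
Proof. exact: cube_int_nabla_dot. Qed.
Lemma QkE k w : Qk k w = ip (Lamn k.-1 w.1) w.2.
Proof. exact: cube_int_nabla_dot. Qed.
Lemma AfunE w : Afun w = mval w mA.
Proof. by rewrite /Afun DkE. Qed.
Lemma Afun_gt0 w : 0 < Afun w. Proof. by rewrite AfunE mvalA_gt0. Qed.
Lemma Afun_neq0 w : Afun w != 0. Proof. by rewrite gt_eqF// Afun_gt0. Qed.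

Definition mden : pexp R mgen := PAdd (PC 1) (PV (mX kD 1)).

Definition c2m (c : cgen) : pexp R mgen :=
  let eb i := PMul (PV (mX kB i.+1)) mden in
  let ed i := PMul (PV mA) (PV (mX kD i.+2)) in
  match c with
  | cA => PV mA
  | cAi => mden
  | cX xE i => PAdd (eb i) (ed i)
  | cX xF i => PAdd (eb i) (PMul (PC (- 1)) (ed i))
  | cX xQ i => PV (mX kQ i.+1)
  end.

Lemma c2m_pos c : pvars mpos (c2m c).
Proof. by case: c => [||[] i]. Qed.

Lemma c2mE w c : peval (mval w) (c2m c) = cval w c.
Proof.
have AV : (Afun w)^-1 = 1 + mval w (mX kD 1) by rewrite AfunE invrK.
case: c => [||[] i] /=.
- by rewrite AfunE.
- by rewrite AV.
- by rewrite /Ek AV DkE BkE AfunE.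
- by rewrite /Fk AV DkE BkE AfunE mulN1r.
- by rewrite QkE.
Qed.

Lemma qfun_c2m e : qfun (psubst c2m e) = cfun e.
Proof.
apply/funext => w; rewrite /qfun peval_psubst; congr (peval _ e).
by apply/funext => c; exact: c2mE.
Qed.

(** Solves E = B / A + A D and F = B / A - A D for B and D.  The last branch
    covers the forms outside [mpos], which have no such expression. *)
Definition m2c (c : mgen) : pexp R cgen :=
  match c with
  | mA => PV cA
  | mX kD 1 => PAdd (PV cAi) (PC (- 1))
  | mX kD i.+2 => PMul (PMul (PC 2^-1) (PV cAi))
      (PAdd (PV (cX xE i)) (PMul (PC (- 1)) (PV (cX xF i))))
  | mX kB i.+1 => PMul (PMul (PC 2^-1) (PV cA)) (PAdd (PV (cX xE i)) (PV (cX xF i)))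
  | mX kQ i.+1 => PV (cX xQ i)
  | _ => PC 0
  end.

Lemma m2cE w c : mpos c -> peval (cval w) (m2c c) = mval w c.
Proof.
have A0 := Afun_neq0 w.
have AV : (Afun w)^-1 = 1 + mval w (mX kD 1) by rewrite AfunE invrK.
case: c => [|[] [|[|i]]] //= _; first exact: AfunE.
1: by rewrite AV /=; ring.
all: by rewrite ?/Ek ?/Fk ?DkE ?BkE ?QkE //=; field.
Qed.

(** Up to the change of generators, the Laurent polynomials in A, E, F, Q are
    the polynomials in A and the forms of positive index, on which the bracket
    has constant structure coefficients. *)
Lemma scrPP (F : functional) : scrP F <-> exists2 e, pvars mpos e & F = qfun e.
Proof.
transitivity (exists e, F = cfun e).
  have [P1 P2] := is_polyP (@Ek R n L) (@Fk R n L) (@Qk R n L) Afun_neq0 F.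
  split=> [/P2 [e eE]|[e eE]]; first by exists e; apply/funext.
  by apply: P1; exists e => w; rewrite eE.
split=> [[e ->]|[e pe ->]].
  exists (psubst c2m e); last by rewrite qfun_c2m.
  by apply: (pvars_psubst _ (pvarsT e)) => c _; exact: c2m_pos.
exists (psubst m2c e); apply/funext => w; rewrite /cfun peval_psubst.
by apply/esym/(eq_peval _ pe) => c; exact: m2cE.
Qed.

Lemma scrP_cfun e : scrP (cfun e).
Proof.
by have [+ _] := is_polyP (@Ek R n L) (@Fk R n L) (@Qk R n L) Afun_neq0 (cfun e);
  apply; exists e.
Qed.

Lemma scrP_cfunP (F : functional) : scrP F -> exists e, F = cfun e.
Proof.
have [_ +] := is_polyP (@Ek R n L) (@Fk R n L) (@Qk R n L) Afun_neq0 F.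
by move=> P2 /P2 [e eE]; exists e; apply/funext.
Qed.

Lemma scrP_poisson : poisson_algebra (@scrP R n L).
Proof.
split.
- by move=> c; apply/scrPP; exists (PC c).
- by move=> F G /scrPP[a pa ->] /scrPP[b pb ->]; apply/scrPP; exists (PAdd a b).
- by move=> F G /scrPP[a pa ->] /scrPP[b pb ->]; apply/scrPP; exists (PMul a b).
- by move=> F /scrPP[a pa ->]; exact: qfun_has_gradients.
- move=> F G /scrPP[a pa ->] /scrPP[b pb ->]; apply/scrPP.
  by exists (mbracket a b); [exact: mbracket_pos|rewrite bracket_qfunE].
- move=> c F G K /scrPP[a _ ->] /scrPP[b _ ->] /scrPP[d _ ->].
  rewrite -(qfunC n L c) -qfunM (bracketDl n L_gt0) qfunM (bracketMl n L_gt0).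
  by rewrite qfunC (bracketKl n L_gt0) mul0r addr0.
- by move=> F G /scrPP[a _ ->] /scrPP[b _ ->]; exact: bracketC.
- by move=> F G K /scrPP[a _ ->] /scrPP[b _ ->] /scrPP[d _ ->]; exact: bracketMl.
- by move=> F G K /scrPP[a _ ->] /scrPP[b _ ->] /scrPP[d _ ->]; exact: jac_qfun.
Qed.

Definition hamE : pexp R mgen :=
  PAdd (PMul (PC 2^-1) (PV (mX kB 0))) (PMul (PC (- 2^-1)) (PV mA)).

Lemma Ham_qfun : @Ham R n L = qfun hamE.
Proof.
apply/funext => w; rewrite /Ham /qfun /= mulNr; congr (_ * _ - _ * (1 + _)^-1).
by rewrite -(DkE 1 w); congr cube_int.
Qed.

(** The bracket with the Hamiltonian in the coordinates A, 1/A, E, F, Q; the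
    division by A makes A drop out of its action on E, F, Q. *)
Definition vfield (x : cgen -> R) (c : cgen) : R :=
  match c with
  | cA => - 2 * x cA * x (cX xQ 0)
  | cAi => 2 * x cAi * x (cX xQ 0)
  | cX xE i => 2 * x (cX xQ 0) * x (cX xF i)
  | cX xF i => 2 * x (cX xQ 0) * x (cX xE i) - 4 * x (cX xQ i.+1)
  | cX xQ i => x (cX xF i)
  end.

Lemma bracket_Ham e w : bracket (cfun e) (@Ham R n L) w =
  Afun w * pdiff (cval w) (vfield (cval w) : _ -> R^o) e.
Proof.
rewrite Ham_qfun -qfun_c2m bracket_qfunE// /qfun /mbracket peval_pder.
rewrite pdiff_psubst (_ : (fun v => _) = cval w); last first.
  by apply/funext => c; exact: c2mE.
rewrite -[RHS](@pdiffZ R R^o); congr pdiff; apply/funext => c.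
have d0 := mA_den_gt0 L_gt0 w; have {}d0 := lt0r_neq0 d0.
rewrite -[RHS]/(_ * _); case: c => [||[] i] /=.
all: rewrite ?/Ek ?/Fk ?AfunE ?DkE ?BkE ?QkE //= ?addn0 ?addn1 ?invrK.
all: move: d0; set d := ip (Lamn 1 w.1) w.1 => d0.
all: rewrite ?regE; by field.
Qed.

End AlgebraP.

(** * The quantities J *)

Section ConservedQuantities.
Variable R : realType.
Implicit Types (x y : cgen -> R) (e : pexp R cgen) (i j k M : nat).

(** The part of J_(i+2) other than E_(i+2), with arbitrary expressions in place
    of the E's so that it can be reused to invert the relation. *)
Definition lower (f : nat -> pexp R cgen) i : pexp R cgen :=
  PAdd
    (pscale (- 1) (psum [seq PMul (PV (cX xQ j)) (PV (cX xQ (i - j)))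
       | j <- iota 0 i.+1]))
    (pscale 4^-1 (psum [seq PAdd (PMul (f j) (f (i.-1 - j)%N))
       (pscale (- 1) (PMul (PV (cX xF j)) (PV (cX xF (i.-1 - j))))) | j <- iota 0 i])).

Definition Evar i : pexp R cgen := PV (cX xE i).

Definition Jexp i : pexp R cgen := PAdd (Evar i) (lower Evar i).

Lemma eq_lower f g i : (forall j, (j < i)%N -> f j = g j) -> lower f i = lower g i.
Proof.
move=> fg; rewrite /lower; congr (PAdd _ (pscale _ (psum _))).
apply/eq_in_map => j; rewrite mem_iota add0n /= => ji.
by rewrite !fg// (leq_ltn_trans (leq_subr _ _))// prednK// (leq_ltn_trans _ ji).
Qed.

Lemma psubst_lower s f i : (forall j, s (cX xF j) = PV (cX xF j)) ->
  (forall j, s (cX xQ j) = PV (cX xQ j)) ->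
  psubst s (lower f i) = lower (fun j => psubst s (f j)) i.
Proof.
move=> sF sQ.
have subst_psum I (r : seq I) (G : I -> pexp R cgen) :
    psubst s (psum [seq G t | t <- r]) = psum [seq psubst s (G t) | t <- r].
  by elim: r => //= t r ->.
rewrite /lower /pscale /= !subst_psum /= !sQ.
congr (PAdd (PMul _ (PAdd _ (psum _))) (PMul _ (psum _))).
  by apply: eq_map => j /=; rewrite !sQ.
by apply: eq_map => j /=; rewrite !sF.
Qed.

Lemma peval_lower f x i : peval x (lower f i) =
  - \sum_(j <- iota 0 i.+1) x (cX xQ j) * x (cX xQ (i - j)) +
  4^-1 * \sum_(j <- iota 0 i) (peval x (f j) * peval x (f (i.-1 - j)%N)
     - x (cX xF j) * x (cX xF (i.-1 - j))).
Proof.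
rewrite /lower /= !peval_psum mulN1r; congr (- _ + _ * _).
  by rewrite big_cons.
by apply: eq_bigr => j _; rewrite /= mulN1r.
Qed.

(** The terms of the derivative cancel in pairs: those of Q_j Q_(i-j) against
    those which the -4 Q_(j+1) in the derivative of F_j brings. *)
Lemma Jexp_conserved x i : pdiff x (vfield x : _ -> R^o) (Jexp i) = 0.
Proof.
pose q j := x (cX xQ j); pose f j := x (cX xF j).
have S : \sum_(j <- iota 0 i.+1) (q j * f (i - j)%N + q (i - j)%N * f j) =
    2 * q 0%N * f i + \sum_(j <- iota 0 i) (q j.+1 * f (i.-1 - j)%N + q (i - j)%N * f j).
  rewrite !big_split.
  have -> : \sum_(j <- iota 0 i.+1) q j * f (i - j)%N =
      q 0%N * f i + \sum_(j <- iota 0 i) q j.+1 * f (i - j.+1)%N.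
    by rewrite (_ : iota 0 i.+1 = 0%N :: iota (1 + 0) i)// big_cons iotaDl big_map subn0.
  rewrite -[i.+1]addn1 iotaD big_cat big_seq1 add0n subnn.
  rewrite [\sum_(j <- _) q j.+1 * f (i - _)%N](eq_bigr
    (fun j => q j.+1 * f (i.-1 - j)%N)).
    by rewrite /=; ring.
  by move=> j _; congr (_ * f _); lia.
rewrite /= !pdiff_psum /= !regE !mulr0 !addr0.
rewrite [X in 4^-1 * X](eq_big_seq (fun j => 4 *
  (q j.+1 * f (i.-1 - j)%N + q (i - j)%N * f j))); last first.
  move=> j; rewrite mem_iota add0n /= => ji; rewrite !regE.
  by rewrite (_ : (i.-1 - j).+1 = i - j)%N /q /f; [ring|lia].
rewrite -mulr_sumr mulrA mulVf ?pnatr_eq0// mul1r.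
move: S; rewrite big_cons; set r := (RHS) => S.
by rewrite [X in -1 * X + _](_ : _ = r)//= /r /q /f; ring.
Qed.

Definition Jstep (f : nat -> pexp R cgen) i : pexp R cgen :=
  PAdd (Evar i) (pscale (- 1) (lower f i)).

(** E_(i+2) as a polynomial in the variables J, F, Q, the names of the E's
    being reused for the J's. *)
Definition Einv i : pexp R cgen := iter i.+1 Jstep (fun=> PC 0) i.

(** [Jstep f i] only involves the values of [f] below [i], so the iterates
    stabilize. *)
Lemma iter_Jstep i N : (i < N)%N -> iter N Jstep (fun=> PC 0) i = Einv i.
Proof.
have [M] := ubnP i; elim: M i N => // M IH i [//|N] iM iN.
rewrite /Einv !iterS /Jstep; congr (PAdd _ (pscale _ _)).
by apply: eq_lower => j ji; rewrite !IH// (leq_trans ji).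
Qed.

Lemma EinvE i : Einv i = Jstep Einv i.
Proof.
rewrite [LHS]/Einv iterS /Jstep; congr (PAdd _ (pscale _ _)).
by apply: eq_lower => j ji; rewrite iter_Jstep.
Qed.

Definition fromJ (c : cgen) : pexp R cgen := if c is cX xE i then Einv i else PV c.

Definition Epoint y (c : cgen) : R := peval y (fromJ c).

Lemma peval_Einv y i : peval y (Einv i) = y (cX xE i) - peval y (lower Einv i).
Proof. by rewrite EinvE /= mulN1r. Qed.

Lemma psubst_fromJ_lower i : psubst fromJ (lower Evar i) = lower Einv i.
Proof. exact: psubst_lower. Qed.

Definition toJ x (c : cgen) : R := if c is cX xE i then peval x (Jexp i) else x c.

Lemma toJK x c : Epoint (toJ x) c = x c.
Proof.
case: c => [||[] i] //; rewrite -[LHS]/(peval (toJ x) (Einv i)).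
have [N] := ubnP i; elim: N i => // N IH i iN.
rewrite peval_Einv -[toJ _ _]/(x (cX xE i) + peval x (lower Evar i)) !peval_lower.
rewrite [X in _ - (_ + _ * X)](eq_big_seq (fun j => x (cX xE j) * x (cX xE (i.-1 - j))
  - x (cX xF j) * x (cX xF (i.-1 - j)))) ?addrK// => j.
rewrite mem_iota add0n => /andP[_ ji].
have ji' : (i.-1 - j < N)%N by lia.
by rewrite !IH//; lia.
Qed.

Definition jfield y (c : cgen) : R := if c is cX xE _ then 0 else vfield (Epoint y) c.

(** Both sides are obtained from the derivatives of lower index by the same
    relation, since J does not move. *)
Lemma jfieldE y c : pdiff y (jfield y : _ -> R^o) (fromJ c) = vfield (Epoint y) c.
Proof.
case: c => [||[] i] //.
have [N] := ubnP i; elim: N i => // N IH i iN.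
rewrite [fromJ _]EinvE -[pdiff _ _ _]/(0 + (-1 *: pdiff y (jfield y : _ -> R^o)
  (lower Einv i) + peval y (lower Einv i) *: 0)).
rewrite scaler0 addr0 add0r -psubst_fromJ_lower pdiff_psubst.
have E := Jexp_conserved (Epoint y) i.
rewrite -[pdiff _ _ (lower _ _)](addKr (vfield (Epoint y) (cX xE i))).
rewrite (_ : pdiff _ _ (lower Evar i) =
    pdiff (Epoint y) (vfield (Epoint y) : _ -> R^o) (lower Evar i)).
  rewrite -[vfield _ _ + _]/(pdiff _ _ (Jexp i)) E.
  by rewrite addr0 scalerN scaleN1r opprK.
pose P c := if c is cX xE j then (j < i)%N else true.
apply: (@eq_pdiff _ _ _ P) => //.
  case=> [||[] j] // ji; exact: IH (leq_trans ji _).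
by rewrite /lower /=; repeat split => //; apply: pvars_psum => j; rewrite mem_iota /= => ji;
  repeat split => //=; lia.
Qed.

End ConservedQuantities.

(** * The kernel of the flow *)

Section Kernel.
Variable R : realType.
Implicit Types (x y : cgen -> R) (e : pexp R cgen) (i j k M : nat).

(** The points where the variables A and 1/A have compatible values. *)
Definition adm y := 0 < y cA /\ y cAi = (y cA)^-1.

Definition upd y (c : cgen) (t : R) (v : cgen) : R := if `[< v = c >] then t else y v.

Definition ind (c : cgen) : cgen -> R := upd (fun=> 0) c 1.

Definition bounded (M N : nat) (c : cgen) : Prop :=
  match c with
  | cX xF i => (i < M)%N
  | cX xQ i => (i < N)%N
  | _ => True
  end.

Lemma upd_eq y c t : upd y c t c = t.
Proof. by rewrite /upd; case: asboolP. Qed.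

Lemma upd_neq y c t v : v <> c -> upd y c t v = y v.
Proof. by rewrite /upd; case: asboolP. Qed.

Lemma upd_adm y (k : ckind) i t : adm y -> adm (upd y (cX k i) t).
Proof. by rewrite /adm !upd_neq. Qed.

Lemma upd_id y c : upd y c (y c) = y.
Proof. by apply/funext => v; rewrite /upd; case: asboolP => // ->. Qed.

Definition zero_at (c v : cgen) : pexp R cgen := if `[< v = c >] then PC 0 else PV v.

Lemma peval_zero_at y c e : peval y (psubst (zero_at c) e) = peval (upd y c 0) e.
Proof.
rewrite peval_psubst; congr (peval _ e); apply/funext => v.
by rewrite /zero_at /upd; case: asboolP.
Qed.

Lemma jfield_F y i : jfield y (cX xF i) =
  2 * y (cX xQ 0) * Epoint y (cX xE i) - 4 * y (cX xQ i.+1).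
Proof. by []. Qed.

(** The value is constant along the line which moves the variable to 0. *)
Lemma eliminate (k : ckind) i e :
  (forall y, adm y -> pdiff y (ind (cX k i) : _ -> R^o) e = 0) ->
  forall y, adm y -> peval y (psubst (zero_at (cX k i)) e) = peval y e.
Proof.
move=> d0 y ay; rewrite peval_zero_at -[in RHS](upd_id y (cX k i)).
apply: (@pdiff0_peval_const _ _ (upd y (cX k i)) (fun=> ind (cX k i))); last first.
  by move=> t; apply: d0; exact: upd_adm.
move=> t v; rewrite /ind /upd; case: asboolP => _.
  exact: is_derive_id.
exact: is_derive_cst.
Qed.

(** In these coordinates E_k involves F's of index below k and Q's of index at
    most k. *)
Lemma Epoint_local y y' k : (forall i, y (cX xE i) = y' (cX xE i)) ->
  (forall i, (i < k)%N -> y (cX xF i) = y' (cX xF i)) ->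
  (forall i, (i <= k)%N -> y (cX xQ i) = y' (cX xQ i)) ->
  Epoint y (cX xE k) = Epoint y' (cX xE k).
Proof.
rewrite -![Epoint _ (cX xE _)]/(peval _ (Einv _ _)) => hE.
have [N] := ubnP k; elim: N k => // N IH k kN hF hQ.
rewrite !peval_Einv !peval_lower hE; congr (_ - (- _ + _ * _)).
  apply: eq_big_seq => j; rewrite mem_iota add0n => /andP[_ jk].
  by rewrite !hQ//; lia.
apply: eq_big_seq => j; rewrite mem_iota add0n => /andP[_ jk].
have loc m : (m < k)%N -> peval y (Einv R m) = peval y' (Einv R m).
  by move=> mk; apply: IH => [|i im|i im]; [|apply: hF|apply: hQ]; lia.
by rewrite !loc ?hF//; lia.
Qed.

(** Moving along the flow keeps A and 1/A compatible, so that the derivative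
    of [e] along it only depends on the values of [e] at such points. *)
Lemma eq_pdiff_jfield e e' :
  (forall y, adm y -> peval y e = peval y e') ->
  forall y, adm y -> pdiff y (jfield y : _ -> R^o) e = pdiff y (jfield y : _ -> R^o) e'.
Proof.
move=> ee' y [y0 yV]; pose h := - 2 * y (cX xQ 0).
pose c (s : R) v := match v with
  | cA => y cA * expR (h * s) | cAi => y cAi * expR (- (h * s))
  | _ => y v + s * jfield y v end.
have c0 : c 0 = y.
  by apply/funext => -[||k i]; rewrite /c ?mulr0 ?oppr0 ?expR0 ?mulr1// mul0r addr0.
have line (a b : R) : is_derive (0 : R) (1 : R) (fun s => a + s * b) b.
  have := is_derive_quad a b 0.
  by under eq_fun do rewrite !mulr0 addr0.
have exp0 (a b : R) : is_derive (0 : R) (1 : R) (fun s => a * expR (b * s)) (a * b).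
  have -> : (fun s => a * expR (b * s)) = a *: (expR \o (b *: id)) by [].
  have H := @is_derive1_comp R expR (b *: id) 0 _ _
    (is_derive_expR _) (is_deriveZ b (is_derive_id (0 : R) (1 : R))).
  apply: (is_derive_eq (is_deriveZ a H)).
  by rewrite -[LHS]/(a * (expR (b * 0) * (b * 1))) mulr0 expR0 mulr1 mul1r.
have dc v : is_derive (0 : R) (1 : R) (c ^~ v) (jfield y v).
  case: v => [||k i]; last exact: line.
    apply: (is_derive_eq (exp0 (y cA) h)).
    by rewrite /jfield /= /Epoint /h /=; ring.
  rewrite (_ : c ^~ cAi = fun s => y cAi * expR (- h * s)); last first.
    by apply/funext => s; rewrite /c mulNr.
  apply: (is_derive_eq (exp0 (y cAi) (- h))).
  by rewrite /jfield /= /Epoint /h /=; ring.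
rewrite -[X in pdiff X _ e]c0 -[X in pdiff X _ e']c0.
apply: eq_pdiff_curve => // s; apply: ee'; split.
  by rewrite /c mulr_gt0// expR_gt0.
by rewrite /c yV expRN invfM.
Qed.

(** Subtracting the two equations leaves the derivative in the direction of
    [c], by linearity of the differential in the tangent vector. *)
Lemma pdiff_ind_eq0 (P : cgen -> Prop) r y y' c e : r != 0 -> pvars P e ->
  (forall v, P v -> y' v = y v) ->
  (forall v, P v -> jfield y' v = r * ind c v + jfield y v) ->
  pdiff y (jfield y : _ -> R^o) e = 0 -> pdiff y' (jfield y' : _ -> R^o) e = 0 ->
  pdiff y (ind c : _ -> R^o) e = 0.
Proof.
move=> r0 Pe yy' jj' d0; rewrite (@eq_pdiff R R^o _ P y' y (jfield y')
  (fun v => r *: (ind c v : R^o) + jfield y v))// pdiff_lin d0 addr0.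
by move=> /eqP; rewrite mulf_eq0 (negbTE r0) => /eqP.
Qed.

Definition stationary e := forall y, adm y -> pdiff y (jfield y : _ -> R^o) e = 0.

Lemma ind_neq c v : v <> c -> ind c v = 0. Proof. exact: upd_neq. Qed.

Lemma cX_inj (k : ckind) i i' : i <> i' -> cX k i <> cX k i'.
Proof. by move=> ii' []. Qed.

(** Among the components relevant to [e], only that of F_M involves Q_(M+1), so
    increasing Q_(M+1) changes the flow in the direction of F_M only. *)
Lemma stationary_F M e : pvars (bounded M.+1 M.+1) e -> stationary e ->
  forall y, adm y -> pdiff y (ind (cX xF M) : _ -> R^o) e = 0.
Proof.
move=> Be st y ay; pose c := cX xQ M.+1; pose y' := upd y c (y c + 1).
have yy' v : bounded M.+1 M.+1 v -> y' v = y v.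
  by move=> Bv; apply: upd_neq => E; move: Bv; rewrite E /= ltnn.
apply: (@pdiff_ind_eq0 (bounded M.+1 M.+1) (- 4) y y') => //.
- have Q0 : y' (cX xQ 0) = y (cX xQ 0) by exact: yy'.
  case=> [||[] i] Bv.
  + rewrite ind_neq// mulr0 add0r -[LHS]/(- 2 * y' cA * y' (cX xQ 0)).
    by rewrite Q0 yy'.
  + rewrite ind_neq// mulr0 add0r -[LHS]/(2 * y' cAi * y' (cX xQ 0)).
    by rewrite Q0 yy'.
  + by rewrite ind_neq// mulr0 add0r.
  + rewrite !jfield_F Q0 (@Epoint_local y' y); first last.
    * by move=> j ji; rewrite yy'//= (leq_ltn_trans ji).
    * by move=> j ji; rewrite yy'//= (ltn_trans ji).
    * by move=> j; rewrite yy'.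
    have [->|iM] := eqVneq i M.
      by rewrite /ind upd_eq /y' upd_eq; ring.
    rewrite ind_neq ?mulr0 ?add0r; last by apply: cX_inj; apply/eqP.
    by rewrite /y' (@upd_neq y c _ (cX xQ i.+1))//; apply: cX_inj => -[] /eqP; apply/negP.
  + by rewrite ind_neq// mulr0 add0r -[LHS]/(y' (cX xF i)) yy'.
- exact: st.
- by apply: st; exact: upd_adm.
Qed.

(** Once F_M is gone, only the component of Q_M involves it. *)
Lemma stationary_Q M e : pvars (bounded M M.+1) e -> stationary e ->
  forall y, adm y -> pdiff y (ind (cX xQ M) : _ -> R^o) e = 0.
Proof.
move=> Be st y ay; pose c := cX xF M; pose y' := upd y c (y c + 1).
have yy' v : bounded M M.+1 v -> y' v = y v.
  by move=> Bv; apply: upd_neq => E; move: Bv; rewrite E /= ltnn.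
apply: (@pdiff_ind_eq0 (bounded M M.+1) 1 y y') => //.
- have Q0 : y' (cX xQ 0) = y (cX xQ 0) by exact: yy'.
  case=> [||[] i] Bv.
  + rewrite ind_neq// mulr0 add0r -[LHS]/(- 2 * y' cA * y' (cX xQ 0)).
    by rewrite Q0 yy'.
  + rewrite ind_neq// mulr0 add0r -[LHS]/(2 * y' cAi * y' (cX xQ 0)).
    by rewrite Q0 yy'.
  + by rewrite ind_neq// mulr0 add0r.
  + rewrite ind_neq// mulr0 add0r !jfield_F Q0 (@Epoint_local y' y) ?yy'//.
    * by move=> j; rewrite yy'.
    * by move=> j ji; rewrite yy'//= (ltn_trans ji).
    * by move=> j ji; rewrite yy'//= ltnS (leq_trans ji)// ltnW.
  + have [->|iM] := eqVneq i M.
      by rewrite /ind upd_eq -[LHS]/(y' c) /y' upd_eq mul1r addrC.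
    rewrite ind_neq ?mulr0 ?add0r; last by apply: cX_inj; apply/eqP.
    by rewrite -[LHS]/(y' (cX xF i)) /y' upd_neq//; apply: cX_inj; apply/eqP.
- exact: st.
- by apply: st; exact: upd_adm.
Qed.

Lemma stationary_zero_at (k : ckind) i e :
  (forall y, adm y -> pdiff y (ind (cX k i) : _ -> R^o) e = 0) ->
  stationary e -> stationary (psubst (zero_at (cX k i)) e).
Proof.
move=> d0 st y ay; rewrite -(st y ay); apply: eq_pdiff_jfield => //.
exact: eliminate.
Qed.

Lemma stationary_reduce M e : pvars (bounded M M) e -> stationary e ->
  exists e', [/\ pvars (bounded 0 0) e', stationary e' &
    forall y, adm y -> peval y e = peval y e'].
Proof.
elim: M e => [|M IH] e Be st; first by exists e.
have dF := stationary_F Be st.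
pose e1 := psubst (zero_at (cX xF M)) e.
have Be1 : pvars (bounded M M.+1) e1.
  apply: pvars_psubst Be => v; rewrite /zero_at; case: asboolP => //=.
  case: v => [||[] i] //= vM; rewrite ltnS leq_eqVlt => /orP[/eqP iM|//].
  by case: vM; rewrite iM.
have st1 : stationary e1 by exact: stationary_zero_at.
have dQ := stationary_Q Be1 st1.
pose e2 := psubst (zero_at (cX xQ M)) e1.
have Be2 : pvars (bounded M M) e2.
  apply: pvars_psubst Be1 => v; rewrite /zero_at; case: asboolP => //=.
  case: v => [||[] i] //= vM; rewrite ltnS leq_eqVlt => /orP[/eqP iM|//].
  by case: vM; rewrite iM.
have [|e' [Be' st' ee']] := IH e2 Be2; first exact: stationary_zero_at.
by exists e'; split => // y ay; rewrite -ee'// !eliminate.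
Qed.

Definition index_lt M (c : cgen) : Prop := if c is cX _ i then (i < M)%N else True.

Lemma index_lt_exists e : exists M, pvars (index_lt M) e.
Proof.
have mono M N c : (M <= N)%N -> index_lt M c -> index_lt N c.
  by move=> MN; case: c => [||k i] //= iM; exact: leq_trans MN.
elim: e => [r|[||k i]|a [M Ha] b [N Hb]|a [M Ha] b [N Hb]]; try by exists 0%N.
- by exists i.+1 => /=.
- exists (maxn M N); split; [apply: sub_pvars Ha|apply: sub_pvars Hb] => c;
    by apply: mono; rewrite (leq_maxl, leq_maxr).
- exists (maxn M N); split; [apply: sub_pvars Ha|apply: sub_pvars Hb] => c;
    by apply: mono; rewrite (leq_maxl, leq_maxr).
Qed.

Definition setA1 (c : cgen) : pexp R nat :=
  match c with cA | cAi => PC 1 | cX xE i => PV i | _ => PC 0 end.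

(** Along the flow with Q_2 = -1/2 the variable A takes every positive value
    while the J's stay fixed. *)
Lemma stationary_A e : pvars (bounded 0 0) e -> stationary e ->
  forall y, adm y -> peval y e = peval (fun i => y (cX xE i)) (psubst setA1 e).
Proof.
move=> Be st y [y0 yV].
pose c (s : R) v := match v with
  | cA => expR s | cAi => expR (- s) | cX xE i => y (cX xE i)
  | cX xF i => 0 | cX xQ i => - 2^-1 end.
pose dc (s : R) v := match v with
  | cA => expR s | cAi => - expR (- s) | cX _ _ => 0 end.
have dcE s v : is_derive s (1 : R) (c ^~ v) (dc s v).
  case: v => [||[] i]; rewrite /c /dc; try exact: is_derive_cst.
    exact: is_derive_expR.
  have H := @is_derive1_comp R expR -%R s _ _ (is_derive_expR _)
    (is_deriveNid s (1 : R)).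
  by apply: (is_derive_eq H); rewrite mulrN1.
have dc0 s : pdiff (c s) (dc s : _ -> R^o) e = 0.
  rewrite -(st (c s)); last by rewrite /adm /= expR_gt0 expRN.
  apply: (@eq_pdiff _ _ _ (bounded 0 0)) => // -[||[] i] //= _.
    by rewrite /Epoint /=; field.
  by rewrite /Epoint /=; field.
have := pdiff0_peval_const dcE dc0 (ln (y cA)) 0.
rewrite (@eq_peval _ _ (bounded 0 0) _ y)//; last first.
  by move=> [||[] i] //= _; rewrite ?expRN lnK ?posrE.
move=> ->; rewrite peval_psubst; apply: (@eq_peval _ _ (bounded 0 0)) => //.
by move=> [||[] i] //= _; rewrite ?oppr0 expR0.
Qed.

(** The F's and Q's are eliminated from the highest index down, then A. *)
Lemma stationary_poly e : stationary e ->
  exists e' : pexp R nat, forall y, adm y ->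
    peval y e = peval (fun i => y (cX xE i)) e'.
Proof.
move=> st; have [M Me] := index_lt_exists e.
have Be : pvars (bounded M M) e by apply: sub_pvars Me => -[||[] i].
have [e' [Be' st' ee']] := stationary_reduce Be st.
by exists (psubst setA1 e') => y ay; rewrite ee'// stationary_A.
Qed.

(** The differential of the change of variables carries [jfield] to [vfield]
    ([jfieldE]), so an expression stationary in the original coordinates is
    stationary in the coordinates A, J, F, Q. *)
Lemma vfield_kernel e :
  (forall x, adm x -> pdiff x (vfield x : _ -> R^o) e = 0) ->
  exists e' : pexp R nat, forall x, adm x ->
    peval x e = peval (fun i => peval x (Jexp R i)) e'.
Proof.
move=> d0; have [|e' eE] := @stationary_poly (psubst (@fromJ R) e).
  move=> y ay; rewrite pdiff_psubst -[RHS](d0 (Epoint y)) //.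
  by congr pdiff; apply/funext => c; exact: jfieldE.
exists e' => x ax; rewrite -(eE (toJ x))// peval_psubst.
by congr (peval _ e); apply/funext => c; exact: (esym (toJK x c)).
Qed.

End Kernel.

(** * Realizing prescribed moments *)

Lemma vandermonde_solve (R : fieldType) (lam : nat -> R) a N (T : nat -> R) :
  injective lam -> (forall m, lam m != 0) ->
  exists x : nat -> R, forall i, (0 < i <= N)%N ->
    \sum_(a <= m < a + N) lam m ^+ i * x m = T i.
Proof.
move=> lam_inj lam0; elim: N T => [|N IH] T.
  by exists (fun=> 0) => i /andP[i0]; rewrite leqNgt i0.
pose l := lam (a + N)%N.
(* solving for the differences T (i+1) - l * T i eliminates the last node *)
have [x' x'E] := IH (fun i => T i.+1 - l * T i).
pose x0 m := x' m / (lam m - l).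
pose x m := if (m == a + N)%N
  then (T 1%N - \sum_(a <= k < a + N) lam k * x0 k) / l else x0 m.
have xlt m : (m < a + N)%N -> x m = x0 m by move=> ml; rewrite /x ltn_eqF.
have sumS i : \sum_(a <= m < a + N.+1) lam m ^+ i * x m =
    \sum_(a <= m < a + N) lam m ^+ i * x0 m + l ^+ i * x (a + N)%N.
  rewrite addnS big_nat_recr ?leq_addr//=; congr (_ + _).
  by apply: eq_big_nat => m /andP[_ ml]; rewrite xlt.
exists x => i /andP[]; elim: i => [//|[|i] IHi] _ iN.
  rewrite sumS [x _]/x eqxx expr1 mulrCA mulfV ?mulr1 ?lam0//.
  by rewrite (eq_bigr (fun k => lam k * x0 k)) 1?addrC ?subrK// => k _; rewrite expr1.
have /x'E H : (0 < i.+1 <= N)%N by exact: iN.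
have {}IHi := IHi isT (ltnW iN).
move: (IHi) (H); rewrite !sumS => IHs Hs.
have step m : (a <= m < a + N)%N ->
    lam m ^+ i.+2 * x0 m = lam m ^+ i.+1 * x' m + l * (lam m ^+ i.+1 * x0 m).
  move=> /andP[_ ml]; rewrite /x0 exprS.
  have dl : lam m - l != 0.
    by rewrite subr_eq0 (inj_eq lam_inj) ltn_eqF.
  by field.
rewrite (eq_big_nat _ _ step) big_split /= Hs -mulr_sumr -addrA exprS -mulrA -mulrDr IHs.
by rewrite subrK.
Qed.

Section Density.
Variables (R : realType) (n : nat) (L : R).
Hypothesis L_gt0 : 0 < L.
Variable i0 : 'I_n.
Local Notation phase := (phase n L).
Local Notation md := (mode L_gt0 i0).
Local Notation lam := (eigval L).

Definition comb (K : nat) (al : nat -> R) : torus_fun n L :=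
  \sum_(0 <= m < K) al m *: md m.

Lemma Lamn_mode i m : Lamn i (md m) = lam m ^+ i *: md m.
Proof.
elim: i => [|i IH]; first by rewrite expr0 scale1r.
by rewrite /Lamn iterS -/(Lamn i _) IH Lam_scale Lam_mode scalerA -exprSr.
Qed.

Lemma LamnD i (f g : torus_fun n L) : Lamn i (f + g) = Lamn i f + Lamn i g.
Proof. by have := Lamn_lin i 1 f g; rewrite !scale1r. Qed.

Lemma LamnZ i a (f : torus_fun n L) : Lamn i (a *: f) = a *: Lamn i f.
Proof. by elim: i => [//|i IH]; rewrite /Lamn !iterS -!/(Lamn i _) IH Lam_scale. Qed.

Lemma ip_comb K i al be : ip (Lamn i (comb K al)) (comb K be) =
  \sum_(0 <= m < K) lam m ^+ i * (ip (md m) (md m) * (al m * be m)).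
Proof.
have orth N k be' : (N <= k)%N -> ip (md k) (comb N be') = 0.
  elim: N => [|N IH] Nk; first by rewrite /comb big_geq// ipC ip0l.
  rewrite /comb big_nat_recr//= ipDr// -/(comb N be') IH ?(ltnW Nk)//.
  by rewrite ipZr// mode_ortho ?mulr0 ?addr0// gtn_eqF.
elim: K => [|K IH].
  by rewrite /comb !big_geq// ipC ip0l.
rewrite big_nat_recr//= -IH /comb !big_nat_recr//= -!/(comb K _).
have o1 := orth K K be (leqnn K).
have o2 : ip (Lamn i (comb K al)) (md K) = 0.
  by rewrite ip_Lamn_sym// Lamn_mode ipZl// orth// mulr0.
rewrite LamnD LamnZ Lamn_mode !(ipDl, ipDr, ipZl, ipZr)// o1 o2.
ring.
Qed.

(** Modes below [N] carry u only, the middle ones u and v equally, the last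
    ones v only: the three families of moments are then linear in the
    nonnegative parameters [x]. *)
Lemma realize N (x : nat -> R) : (forall m, 0 <= x m) -> exists w : phase,
  [/\ forall i, mval w (mX kD i) = \sum_(0 <= m < N + N) lam m ^+ i * x m,
      forall i, mval w (mX kB i) = \sum_(N <= m < N + N + N) lam m ^+ i * x m &
      forall i, mval w (mX kQ i) = \sum_(N <= m < N + N) lam m ^+ i * x m].
Proof.
move=> x0; pose s m := Num.sqrt (x m / ip (md m) (md m)).
have c0 m : ip (md m) (md m) != 0 by rewrite gt_eqF// ip_gt0// mode_neq0.
have ss m : ip (md m) (md m) * (s m * s m) = x m.
  rewrite -expr2 sqr_sqrtr ?divr_ge0 ?ip_ge0// mulrC divfK//.
pose al m := if (m < N + N)%N then s m else 0.
pose be m := if (N <= m)%N then s m else 0.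
have sum_if (a b c d : nat) (F G : nat -> R) :
    (a <= c <= d)%N -> (d <= b)%N ->
    (forall m, (c <= m < d)%N -> F m = G m) ->
    (forall m, (a <= m < c)%N || (d <= m < b)%N -> F m = 0) ->
    \sum_(a <= m < b) F m = \sum_(c <= m < d) G m.
  move=> /andP[ac cd] db FG F0.
  rewrite (@big_cat_nat _ _ _ c)//= ?(leq_trans cd)// (@big_cat_nat _ _ _ d _ b)//=.
  rewrite big_nat big1 ?add0r; last by move=> m mac; rewrite F0// mac.
  rewrite [X in _ + X]big_nat [X in _ + X]big1 ?addr0; last first.
    by move=> m mdb; rewrite F0// mdb orbT.
  exact: eq_big_nat.
exists (comb (N + N + N) al, comb (N + N + N) be); split=> i; rewrite /= ip_comb.
- apply: sum_if; rewrite ?leq_addr//.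
    by move=> m /andP[_ mN]; rewrite /al mN ss.
  by move=> m /orP[|/andP[mN _]]; [lia|]; rewrite /al ltnNge mN !mul0r !mulr0.
- apply: sum_if; rewrite ?leqnn ?leq0n//= ?(leq_trans (leq_addr _ _) (leq_addr _ _))//.
    by move=> m /andP[mN _]; rewrite /be mN ss.
  by move=> m H; rewrite /be (_ : (N <= m)%N = false) ?mul0r ?mulr0//; lia.
- apply: sum_if; rewrite ?leq_addr//.
    by move=> m /andP[mN mN2]; rewrite /al /be mN mN2 ss.
  move=> m H; rewrite /al /be; case: ifP => h1; case: ifP => h2;
    rewrite ?mul0r ?mulr0//; lia.
Qed.

(** Three Vandermonde systems; the middle group is solved first, for Q, and
    subtracted from the targets D and B.  The parameters may be negative. *)
Lemma moments_onto N (D B Q : nat -> R) : exists x : nat -> R, forall i,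
  (0 < i <= N)%N ->
  [/\ \sum_(0 <= m < N + N) lam m ^+ i * x m = D i,
      \sum_(N <= m < N + N + N) lam m ^+ i * x m = B i &
      \sum_(N <= m < N + N) lam m ^+ i * x m = Q i].
Proof.
have inj := eigval_inj L_gt0; have nz m : lam m != 0 by rewrite gt_eqF// eigval_gt0.
have [xq xqE] := vandermonde_solve N N Q inj nz.
have [xd xdE] := vandermonde_solve 0 N (fun i => D i - Q i) inj nz.
have [xb xbE] := vandermonde_solve (N + N) N (fun i => B i - Q i) inj nz.
pose x m := if (m < N)%N then xd m else if (m < N + N)%N then xq m else xb m.
exists x => i iN.
have sd : \sum_(0 <= m < N) lam m ^+ i * x m = D i - Q i.
  rewrite -xdE// add0n; apply: eq_big_nat => m /andP[_ mN].
  by rewrite /x mN.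
have sq : \sum_(N <= m < N + N) lam m ^+ i * x m = Q i.
  rewrite -xqE//; apply: eq_big_nat => m /andP[mN mN2].
  by rewrite /x ltnNge mN mN2.
have sb : \sum_(N + N <= m < N + N + N) lam m ^+ i * x m = B i - Q i.
  rewrite -xbE//; apply: eq_big_nat => m /andP[mN _].
  by rewrite /x !ltnNge mN (leq_trans (leq_addr _ _) mN).
split=> //.
- by rewrite (@big_cat_nat _ _ _ N)//= ?leq_addr// sd sq subrK.
- by rewrite (@big_cat_nat _ _ _ (N + N))//= ?leq_addr// sq sb addrC subrK.
Qed.

End Density.

(** * From identities of functionals to identities of expressions *)

Section Rational.
Variables (R : realType) (pa : {poly R}) (pD pB pQ : nat -> {poly R}).

(** The point with coordinates 1/A = pa(t) and quadratic functionals pD(t),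
    pB(t), pQ(t). *)
Definition ratpoint (t : R) (c : cgen) : R :=
  match c with
  | cA => pa.[t]^-1
  | cAi => pa.[t]
  | cX xE i => (pB i).[t] * pa.[t] + pa.[t]^-1 * (pD i).[t]
  | cX xF i => (pB i).[t] * pa.[t] - pa.[t]^-1 * (pD i).[t]
  | cX xQ i => (pQ i).[t]
  end.

(** Powers of [pa] clear the denominators. *)
Lemma peval_ratpoint (e : pexp R cgen) : exists m (p : {poly R}), forall t,
  pa.[t] != 0 -> peval (ratpoint t) e * pa.[t] ^+ m = p.[t].
Proof.
elim: e => [r|[||[] i]|a [m [p pE]] b [k [q qE]]|a [m [p pE]] b [k [q qE]]].
- by exists 0%N, r%:P => t _; rewrite hornerC expr0 mulr1.
- by exists 1%N, 1 => t at0; rewrite hornerC expr1 /= mulVf.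
- by exists 0%N, pa => t _; rewrite expr0 mulr1.
- exists 1%N, (pB i * pa ^+ 2 + pD i) => t at0; rewrite !hornerE /=; by field.
- exists 1%N, (pB i * pa ^+ 2 - pD i) => t at0; rewrite !hornerE /=; by field.
- by exists 0%N, (pQ i) => t _; rewrite expr0 mulr1.
- exists (m + k)%N, (p * pa ^+ k + q * pa ^+ m) => t at0.
  by rewrite !hornerE /= -pE// -qE// exprD; ring.
- exists (m + k)%N, (p * q) => t at0.
  by rewrite !hornerE /= -pE// -qE// exprD; ring.
Qed.

End Rational.

Lemma poly_eq0_harmonic (R : realType) (p : {poly R}) (K : nat) :
  (forall j, p.[(K + j).+1%:R^-1] = 0) -> p = 0.
Proof.
move=> p0; apply/eqP; apply: contraT => pn0.
pose rs := [seq ((K + j).+1%:R^-1 : R) | j <- iota 0 (size p)].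
have := @max_poly_roots _ p rs pn0; rewrite size_map size_iota ltnn; apply.
  by apply/allP => _ /mapP[j _ ->]; rewrite /root p0.
rewrite map_inj_uniq ?iota_uniq// => i j /invr_inj /eqP.
by rewrite eqr_nat eqSS eqn_add2l => /eqP.
Qed.

Section Final.
Variables (R : realType) (n : nat) (L : R).
Hypothesis L_gt0 : 0 < L.
Variable i0 : 'I_n.
Local Notation phase := (phase n L).
Local Notation lam := (eigval L).

(** The target [x] is reached with real parameters [y].  On the segment from the
    parameters all equal to 1 to [y], the value of [e] is a rational function
    of the position; near the first end the parameters are positive, so the
    points are realized and the function vanishes there, hence also at [x]. *)
Lemma identity_everywhere (e : pexp R cgen) :
  (forall w : phase, peval (cval w) e = 0) -> forall x, adm x -> peval x e = 0.
Proof.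
move=> e0 x [x0 xV]; have [M Me] := index_lt_exists e.
pose a := x cAi.
have a0 : 0 < a by rewrite /a xV invr_gt0.
have aV : x cA = a^-1 by rewrite /a xV invrK.
pose D i : R := if i is k.+2 then (x (cX xE k) - x (cX xF k)) * a / 2 else a - 1.
pose B i : R := (x (cX xE i.-1) + x (cX xF i.-1)) / (2 * a).
pose Q i : R := x (cX xQ i.-1).
have [y yE] := moments_onto L_gt0 M.+1 D B Q.
set N := M.+1 in yE.
pose mom b c i (z : nat -> R) : R := \sum_(b <= m < c) lam m ^+ i * z m.
pose z (t : R) m : R := 1 + t * (y m - 1).
pose pmom b c i : {poly R} :=
  (mom b c i (fun=> 1))%:P + 'X * (mom b c i y - mom b c i (fun=> 1))%:P.
have pmomE b c i t : (pmom b c i).[t] = mom b c i (z t).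
  rewrite !hornerE /mom -sumrB mulr_sumr -big_split /=.
  by apply: eq_bigr => m _; rewrite /z; ring.
pose pa := 1%:P + pmom 0%N (N + N)%N 1%N.
pose pD i := pmom 0%N (N + N)%N i.+2.
pose pB i := pmom N (N + N + N)%N i.+1.
pose pQ i := pmom N (N + N)%N i.+1.
have [m [p pE]] := peval_ratpoint pa pD pB pQ e.
have [K KP] : exists K : nat, forall m, (m < N + N + N)%N -> `|y m - 1| <= K%:R.
  exists (Num.bound (\sum_(0 <= m < N + N + N) `|y m - 1|)) => j jN.
  apply: le_trans (ltW (archi_boundP _)); last by apply: sumr_ge0.
  by rewrite (bigD1_seq j) ?mem_index_iota ?iota_uniq//= lerDl sumr_ge0.
have p0 : p = 0.
  apply: (@poly_eq0_harmonic _ _ K) => j.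
  set t := _^-1; have t0 : 0 < t by rewrite invr_gt0.
  have zt0 k : (k < N + N + N)%N -> 0 <= z t k.
    move=> kN; have := KP k kN; rewrite ler_norml => /andP[h _].
    rewrite /z -(@ler_pM2l _ (K + j).+1%:R)// mulr0 mulrDr mulr1 mulrA mulfV// mul1r.
    rewrite -natr1 natrD; have : 0 <= j%:R :> R by []; lra.
  have H0 k : 0 <= (if (k < N + N + N)%N then z t k else 0).
    by case: ifP => [/zt0|].
  have [w [wD wB wQ]] := realize L_gt0 i0 N H0.
  have momE b c i : (c <= N + N + N)%N ->
      \sum_(b <= m < c) lam m ^+ i * (if (m < N + N + N)%N then z t m else 0) =
      mom b c i (z t).
    move=> cN; apply: eq_big_nat => k /andP[_ kc].
    by rewrite (leq_trans kc cN).
  have NN : (N + N <= N + N + N)%N by rewrite leq_addr.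
  have paE : pa.[t] = 1 + ip (Lamn 1 w.1) w.1.
    by rewrite /pa hornerD hornerC pmomE -[ip _ _]/(mval w (mX kD 1)) wD momE.
  have pc : ratpoint pa pD pB pQ t = cval w.
    apply/funext => c; rewrite -c2mE//; case: c => [||[] i];
      by rewrite /= ?paE// ?pmomE -?momE// -?wD -?wB -?wQ /= ?mulN1r.
  by rewrite -pE ?paE ?lt0r_neq0 ?mA_den_gt0// pc e0 mul0r.
have z1 : z 1 = y by apply/funext => k; rewrite /z mul1r addrC subrK.
have p1 : pa.[1] = a.
  have [yD _ _] := yE 1%N isT.
  by rewrite /pa hornerD hornerC pmomE z1 /mom yD /D addrC subrK.
have := pE 1; rewrite p0 horner0 p1 => /(_ (lt0r_neq0 a0)) /eqP.
rewrite mulf_eq0 expf_eq0 (negbTE (lt0r_neq0 a0)) andbF orbF => /eqP <-.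
apply: (@eq_peval _ _ (index_lt M)) Me => -[||k i] /=; rewrite ?p1//.
move=> iM; have [|_ yB yQ] := yE i.+1; first by rewrite /N; lia.
have [|yD _ _] := yE i.+2; first by rewrite /N; lia.
have a1 := lt0r_neq0 a0.
case: k; rewrite /= ?pmomE z1 /mom ?yD ?yB ?yQ /D /B /Q /=.
- by field.
- by field.
- by [].
Qed.

End Final.

(** * Constants of motion *)

Section ConstantsOfMotion.
Variables (R : realType) (n : nat) (L : R).
Hypothesis L_gt0 : 0 < L.
Local Notation phase := (phase n L).
Local Notation functional := (functional n L).
Local Notation J := (@Jk R n L).
Local Notation qfun := (@qfun R n L).
Implicit Types (w : phase).

Lemma JkE i w : J i.+2 w = peval (cval w) (Jexp R i).
Proof.
have shift m (G : nat -> R) :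
    \sum_(2 <= j < m.+2) G j = \sum_(j <- iota 0 m) G j.+2.
  by rewrite /index_iota !subSS subn0 (iotaDl 2 0) big_map.
rewrite -[RHS]/(Ek i.+2 w + peval (cval w) (lower (@Evar R) i)) peval_lower.
rewrite /Jk /= !shift -addrA; congr (_ + (- _ + _ * _)).
  rewrite !big_seq; apply: eq_bigr => j; rewrite mem_iota add0n => /andP[_ ji].
  by rewrite (_ : (i.+2 + 2 - j.+2 = (i - j).+2)%N) //; lia.
rewrite !big_seq; apply: eq_bigr => j; rewrite mem_iota add0n => /andP[_ ji].
by rewrite (_ : (i.+2 + 1 - j.+2 = (i.-1 - j).+2)%N) //; lia.
Qed.

Lemma cval_adm w : adm (cval w).
Proof. by split; rewrite ?Afun_gt0. Qed.

Definition vfieldE (c : cgen) : pexp R cgen :=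
  match c with
  | cA => PMul (PC (- 2)) (PMul (PV cA) (PV (cX xQ 0)))
  | cAi => PMul (PC 2) (PMul (PV cAi) (PV (cX xQ 0)))
  | cX xE i => PMul (PC 2) (PMul (PV (cX xQ 0)) (PV (cX xF i)))
  | cX xF i => PAdd (PMul (PC 2) (PMul (PV (cX xQ 0)) (PV (cX xE i))))
                 (PMul (PC (- 4)) (PV (cX xQ i.+1)))
  | cX xQ i => PV (cX xF i)
  end.

Lemma peval_vfieldE x c : peval x (vfieldE c) = vfield x c.
Proof. by case: c => [||[] i] /=; ring. Qed.

Lemma pdiff0 V (f : V -> R) e : pdiff f (fun=> 0 : R^o) e = 0.
Proof. by elim: e => //= [a -> b ->|a -> b ->]; rewrite ?scaler0 addr0. Qed.

Lemma cfun_has_gradients (e : pexp R cgen) : has_gradients (@cfun R n L e).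
Proof. by rewrite -qfun_c2m//; exact: qfun_has_gradients. Qed.

Local Notation one := (fun (_ : nat) (_ : phase) => 1 : R).

Lemma polynomials_in_JP (F : functional) : polynomials_in_J F <->
  exists e : pexp R nat, F = fun w => peval (fun i => J i.+2 w) e.
Proof.
have nz (w : phase) : (fun=> 1 : R) w != 0 by exact: oner_neq0.
have monE M d a b c w : gmon (fun=> 1) J one one M d a b c w =
    \prod_(2 <= k < M.+1) J k w ^+ a k.
  by rewrite /gmon exp1rz mul1r; apply: eq_bigr => k _; rewrite !expr1n !mulr1.
have [P1 P2] := is_polyP J one one nz F.
split=> [[m [M [coef [a FE]]]]|[e FE]].
  have [|e eE] := P2.
    exists m, M, coef, (fun=> 0), a, (fun _ _ => 0%N), (fun _ _ => 0%N).
    by rewrite FE; apply/funext => w; apply: eq_bigr => i _; rewrite monE.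
  exists (psubst (fun c => if c is cX xE i then PV i else PC 1) e).
  apply/funext => w; rewrite eE peval_psubst; congr (peval _ e).
  by apply/funext => -[||[] i] //=; rewrite invr1.
have [|m [M [coef [d [a [b [c FE']]]]]]] := P1.
  by exists (psubst (fun i => PV (cX xE i)) e) => w; rewrite FE peval_psubst.
exists m, M, coef, a; rewrite FE'; apply/funext => w.
by apply: eq_bigr => i _; rewrite monE.
Qed.

Lemma polynomials_in_J_scrC (F : functional) : polynomials_in_J F -> scrC F.
Proof.
move=> /polynomials_in_JP[e ->].
have -> : (fun w => peval (fun i => J i.+2 w) e) = cfun (psubst (Jexp R) e).
  apply/funext => w; rewrite /cfun peval_psubst; congr (peval _ e).
  by apply/funext => i; rewrite JkE.
split; first exact: scrP_cfun.
split; first exact: cfun_has_gradients.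
apply/funext => w; rewrite bracket_Ham// pdiff_psubst -[RHS](mulr0 (Afun w)).
congr (_ * _); rewrite -[RHS](pdiff0 (fun i => peval (cval w) (Jexp R i)) e).
by congr pdiff; apply/funext => i; exact: Jexp_conserved.
Qed.

(** The derivative of [e] along the flow vanishes at all phase points, hence
    identically. *)
Lemma scrC_polynomials_in_J (i0 : 'I_n) (F : functional) :
  scrC F -> polynomials_in_J F.
Proof.
move=> [/(scrP_cfunP L_gt0)[e ->] [_ H]].
have [|e' eE] := @vfield_kernel R e.
  move=> x ax; have := @identity_everywhere R n L L_gt0 i0 (pder vfieldE e).
  move=> /(_ _ x ax); rewrite peval_pder.
  have -> : (fun c => peval x (vfieldE c)) = vfield x.
    by apply/funext => c; exact: peval_vfieldE.
  apply=> w; rewrite peval_pder.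
  have -> : (fun c => peval (cval w) (vfieldE c)) = vfield (cval w).
    by apply/funext => c; exact: peval_vfieldE.
  have := congr1 (fun G : functional => G w) H; rewrite bracket_Ham// => /eqP.
  by rewrite mulf_eq0 (negbTE (Afun_neq0 L_gt0 w)) => /eqP.
apply/polynomials_in_JP; exists e'; apply/funext => w.
rewrite /cfun eE; last exact: cval_adm.
by congr (peval _ e'); apply/funext => i; rewrite JkE.
Qed.

(** Time reversal. *)
Definition flip w : phase := (w.1, - w.2).

Lemma flip_grad_u (F : functional) w g : (forall w, F (flip w) = F w) ->
  is_grad_u F w g -> is_grad_u F (flip w) g.
Proof.
move=> Fe Fg phi; have := Fg phi.
suff -> : (fun s : R => F ((flip w).1 + s *: phi, (flip w).2)) =
  (fun s : R => F (w.1 + s *: phi, w.2)) by [].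
by apply/funext => s; rewrite -[RHS]Fe.
Qed.

Lemma flip_grad_v (F : functional) w g : (forall w, F (flip w) = F w) ->
  is_grad_v F w g -> is_grad_v F (flip w) (- g).
Proof.
move=> Fe Fg phi; have := Fg (- phi).
rewrite -![cube_int _ _]/(ip _ _) (_ : ip g (- phi) = ip (- g) phi); last first.
  by rewrite ipC ipNl// ipC ipNl.
suff -> : (fun s : R => F ((flip w).1, (flip w).2 + s *: phi)) =
  (fun s : R => F (w.1, w.2 + s *: - phi)) by [].
apply/funext => s; rewrite -[RHS]Fe /flip /=; congr (F (_, _)).
by rewrite scalerN opprB addrC.
Qed.

Lemma bracket_flip (F G : functional) w : has_gradients F -> has_gradients G ->
  (forall w, F (flip w) = F w) -> (forall w, G (flip w) = G w) ->
  bracket F G (flip w) = - bracket F G w.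
Proof.
move=> gF gG Fe Ge.
have [[fu Fu] [fv Fv]] := gF w; have [[gu Gu] [gv Gv]] := gG w.
rewrite !bracket_ip// (grad_uE L_gt0 Fu) (grad_vE L_gt0 Fv) (grad_uE L_gt0 Gu).
rewrite (grad_vE L_gt0 Gv) (grad_uE L_gt0 (flip_grad_u Fe Fu)).
rewrite (grad_vE L_gt0 (flip_grad_v Fe Fv)) (grad_uE L_gt0 (flip_grad_u Ge Gu)).
rewrite (grad_vE L_gt0 (flip_grad_v Ge Gv)) ipNl// [ip fu (- gv)]ipC ipNl//.
by rewrite [ip gv fu]ipC; ring.
Qed.

Lemma Jk_flip i w : J i.+2 (flip w) = J i.+2 w.
Proof.
have L0 k : Lamn k (0 : torus_fun n L) = 0.
  by rewrite -[0 in LHS](scale0r 0) LamnZ scale0r.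
have LN k (f : torus_fun n L) : Lamn k (- f) = - Lamn k f.
  by rewrite -scaleN1r LamnZ scaleN1r.
have bN k : Bk k (flip w) = Bk k w.
  by rewrite !BkE//= LN ipNl// ipC ipNl// opprK ipC.
have qN k : Qk k (flip w) = - Qk k w.
  by rewrite !QkE//= ipC ipNl// ipC.
rewrite /Jk /=.
rewrite (_ : Ek i.+2 (flip w) = Ek i.+2 w); last by rewrite /Ek bN.
congr (_ - _ + _ * _); apply: eq_bigr => j _.
  by rewrite !qN mulrNN.
by rewrite /Ek /Fk !bN.
Qed.

Lemma Jk1_Ham : J 1 = (fun=> - 2) * @Ham R n L + (fun=> - 1).
Proof.
apply/funext => w; rewrite Ham_qfun//.
rewrite -[RHS]/(-2 * (2^-1 * ip (Lamn 0 w.2) w.2 + - 2^-1 * mval w mA) + -1).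
rewrite -[LHS]/(Afun w - Bk 1 w - 1) AfunE// BkE//=.
by set a := (1 + _)^-1; field.
Qed.

Lemma Jk_scrC i : scrC (J i.+2).
Proof.
apply: polynomials_in_J_scrC; apply/polynomials_in_JP.
by exists (PV i).
Qed.

Lemma Jk_cfun i : J i.+2 = cfun (Jexp R i).
Proof. by apply/funext => w; exact: JkE. Qed.

Lemma Jk_qfun k : (0 < k)%N -> exists e, J k = qfun e.
Proof.
case: k => [//|[|i]] _; last by eexists; rewrite Jk_cfun -qfun_c2m.
exists (PAdd (PMul (PC (- 2)) (hamE R)) (PC (- 1))).
by rewrite qfunD qfunM !qfunC -Ham_qfun// Jk1_Ham.
Qed.

Lemma bracket_Jk_Ham k : (0 < k)%N -> bracket (J k) (@Ham R n L) = 0.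
Proof.
case: k => [//|[|i]] _; last by have [_ [_]] := Jk_scrC i.
have HH : bracket (@Ham R n L) (@Ham R n L) = 0.
  apply/funext => w; have := bracketC n L_gt0 (hamE R) (hamE R).
  move=> /(congr1 (fun F : functional => F w)); rewrite -Ham_qfun//.
  rewrite -[(- _) w]/(- (bracket (@Ham R n L) (@Ham R n L) w)).
  by move=> /eqP; rewrite -addr_eq0 -mulr2n mulrn_eq0 => /eqP.
rewrite Jk1_Ham Ham_qfun// -(qfunC n L (- 2)) -(qfunC n L (- 1)) -qfunM.
rewrite (bracketDl n L_gt0) qfunM (bracketMl n L_gt0) !qfunC !(bracketKl n L_gt0).
by rewrite -Ham_qfun// HH mulr0 mul0r !addr0.
Qed.

Lemma bracket_Jk1 k : (0 < k)%N -> bracket (J 1) (J k) = 0.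
Proof.
move=> k0; have [e eE] := Jk_qfun k0; have := bracket_Jk_Ham k0.
rewrite Jk1_Ham eE Ham_qfun// (bracketC n L_gt0) => /eqP; rewrite oppr_eq0 => /eqP H.
rewrite -(qfunC n L (- 2)) -(qfunC n L (- 1)) -qfunM.
rewrite (bracketDl n L_gt0) qfunM (bracketMl n L_gt0) !qfunC !(bracketKl n L_gt0) H.
by rewrite mulr0 mul0r !addr0.
Qed.

(** The bracket of two conserved quantities is conserved by the Jacobi identity,
    hence a polynomial in the J's, hence even in v; but the bracket of two
    functionals even in v is odd in v. *)
Lemma bracket_Jk_Jk (i0 : 'I_n) i j : bracket (J i.+2) (J j.+2) = 0.
Proof.
have [a aE] := @Jk_qfun i.+2 isT; have [b bE] := @Jk_qfun j.+2 isT.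
have gi : has_gradients (J i.+2) by rewrite aE; exact: qfun_has_gradients.
have gj : has_gradients (J j.+2) by rewrite bE; exact: qfun_has_gradients.
have hi := @bracket_Jk_Ham i.+2 isT; have hj := @bracket_Jk_Ham j.+2 isT.
have z d : bracket (qfun d) (0 : functional) = 0.
  by rewrite -[0 : functional]/(qfun (PC 0)) (bracketC n L_gt0) qfunC (bracketKl n L_gt0) oppr0.
have CK : scrC (bracket (J i.+2) (J j.+2)).
  split.
    have P := @scrP_poisson R n L L_gt0.
    exact: (pa_bracket P (Jk_scrC i).1 (Jk_scrC j).1).
  split; first by rewrite aE bE (bracket_qfunE n L_gt0); exact: qfun_has_gradients.
  have h1 : bracket (qfun b) (qfun (hamE R)) = 0 by rewrite -bE -Ham_qfun.
  have h2 : bracket (qfun (hamE R)) (qfun a) = 0.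
    by rewrite (bracketC n L_gt0) -aE -Ham_qfun// hi oppr0.
  have := jac_qfun n L_gt0 a b (hamE R); rewrite /jac h1 h2 !z !add0r => H.
  rewrite aE bE Ham_qfun// (bracket_qfunE n L_gt0) (bracketC n L_gt0).
  by rewrite -(bracket_qfunE n L_gt0) H oppr0.
have /polynomials_in_JP[e eE] := scrC_polynomials_in_J i0 CK.
apply/funext => w; have := bracket_flip w gi gj (Jk_flip i) (Jk_flip j).
rewrite eE (_ : (fun i => J i.+2 (flip w)) = fun i => J i.+2 w); last first.
  by apply/funext => k; exact: Jk_flip.
by move=> /eqP; rewrite -addr_eq0 -mulr2n mulrn_eq0 => /eqP.
Qed.

End ConstantsOfMotion.

Theorem proposition3p2 (R : realType) (n : nat) (L : R)
    (hn : (1 <= n)%N) (hL : 0 < L) :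
  [/\ poisson_algebra (@scrP R n L),
      @scrC R n L = @polynomials_in_J R n L,
      has_gradients (@Ham R n L) /\
        (forall k : nat, (1 <= k)%N -> has_gradients (@Jk R n L k)) &
      forall k1 k2 : nat, (1 <= k1)%N -> (1 <= k2)%N ->
        bracket (@Jk R n L k1) (@Jk R n L k2) = 0].
Proof.
split.
- exact: scrP_poisson.
- apply/seteqP; split => F; first exact: (scrC_polynomials_in_J hL (Ordinal hn)).
  exact: polynomials_in_J_scrC.
- split; first by rewrite Ham_qfun//; exact: qfun_has_gradients.
  by move=> k k0; have [e ->] := Jk_qfun n hL k0; exact: qfun_has_gradients.
- move=> k1 k2 k10 k20; case: k1 k10 => [//|[|i]] _; first exact: bracket_Jk1.
  case: k2 k20 => [//|[|j]] _; last exact: bracket_Jk_Jk (Ordinal hn) i j.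
  have [a aE] := @Jk_qfun R n L hL i.+2 isT; have [b bE] := @Jk_qfun R n L hL 1 isT.
  rewrite aE bE (bracketC n hL) -aE -bE bracket_Jk1// oppr0 //.
Qed.
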